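(* Let $(k_n)_{n\in\mathbb{N}}$ be a sequence of positive numbers satisfying $k_n\to\infty$ and $k_n=o(\log n)$ as $n\to\infty$. Let $X_n(k)$ denote the number of vertices at level $k$ (distance $k$ from the root) in a random recursive tree with $n+1$ vertices. Then, as $n\to\infty$, $$\Bigg(\frac{[k_n]^{1/2}([k_n u]-1)!\big(X_n([k_n u])-(\log n)^{[k_n u]}/[k_n u]!\big)}{(\log n)^{[k_n u]-1/2}}\Bigg)_{u>0}$$ converges in the sense of finite-dimensional distributions to $$\Bigg(\int_{[0,\infty)}e^{-uy}\,{\rm d}B(y)\Bigg)_{u>0},$$ where $(B(v))_{v\geq 0}$ is a standard Brownian motion.
   Context: A recursive tree with $n$ vertices is a rooted tree with vertices labeled $1,\dots,n$, root labeled $1$, such that labels along the unique path from the root to any vertex are increasing. A random recursive tree with $n$ vertices is a tree chosen uniformly at random among the $(n-1)!$ recursive trees with $n$ vertices. $[x]$ denotes the integer part of $x$. The limit process is defined via integration by parts: $\int_{[0,\infty)}e^{-uy}{\rm d}B(y):=u\int_0^\infty e^{-uy}B(y)\,{\rm d}y$ for $u>0$; it is a centered Gaussian process with covariance $(u,v)\mapsto (u+v)^{-1}$. (For each fixed $u>0$, the displayed expression is well defined for all sufficiently large $n$.) *)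

(* Defs.v *)
From HB Require Import structures.
From mathcomp Require Import all_boot all_order all_algebra.
From mathcomp Require Import all_classical all_reals all_analysis.
Set Implicit Arguments. Unset Strict Implicit. Unset Printing Implicit Defensive.
Import Order.TTheory GRing.Theory Num.Theory.
Import numFieldNormedType.Exports.
Local Open Scope ring_scope.

(* ---------- Random recursive trees ----------
   A recursive tree with n+1 vertices is encoded with vertex labels 0..n
   (label j here = label j+1 in the paper; root = 0).  For i : 'I_n, t i is
   the parent of vertex i+1; the recursive (increasing-labels) condition is
   exactly  t i <= i.  This is a bijection with recursive trees on n+1
   vertices (there are n! of them). *)
Definition rtree_code (n : nat) := {ffun 'I_n -> 'I_n.+1}.

Definition rec_trees (n : nat) : {set rtree_code n} :=
  [set t : rtree_code n | [forall i : 'I_n, (t i <= i)%N]].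

(* parent of vertex j+1, as a nat function (junk outside range) *)
Definition rparent (n : nat) (t : rtree_code n) (j : nat) : nat :=
  if @insub _ (fun x => (x < n)%N) 'I_n j is Some i then nat_of_ord (t i) else 0%N.

(* depth (distance to the root) of vertex j, computed with fuel;
   fuel j suffices since parents have smaller labels *)
Fixpoint rdepth_fuel (n : nat) (t : rtree_code n) (fuel j : nat) : nat :=
  match fuel with
  | 0 => 0
  | fuel'.+1 => match j with
                | 0 => 0
                | j'.+1 => (rdepth_fuel t fuel' (rparent t j')).+1
                end
  end.

Definition rdepth (n : nat) (t : rtree_code n) (j : nat) : nat :=
  rdepth_fuel t j j.

Definition level_count (n : nat) (t : rtree_code n) (k : nat) : nat :=
  #|[set j : 'I_n.+1 | rdepth t j == k]|.

Definition rrt_expect (R : realType) (n : nat) (F : rtree_code n -> R) : R :=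
  (#|rec_trees n|%:R)^-1 * \sum_(t in rec_trees n) F t.

Definition Yn (R : realType) (k : nat -> R) (n : nat) (u : R)
  (t : rtree_code n) : R :=
  let K := Num.truncn (k n * u) in
  let L := ln (n%:R : R) in
  Num.sqrt ((Num.truncn (k n))%:R) * (K.-1)`!%:R
  * ((level_count t K)%:R - L ^+ K / (K`!)%:R)
  / (L `^ (K%:R - 2^-1)).

(* ---------- Centered Gaussian random vectors ----------
   Z : T -> 'rV_m is a centered Gaussian vector with covariance matrix S
   (possibly degenerate) iff its coordinates are measurable and its
   characteristic function is  E exp(i <t,Z>) = exp(-1/2 t S t^T),
   written here via real and imaginary parts. *)
Definition centered_gaussian_vec (R : realType) (d : measure_display)
  (T : measurableType d) (P : probability T R) (m : nat)
  (Z : T -> 'rV[R]_m) (S : 'M[R]_m) : Prop :=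
  (forall i : 'I_m, measurable_fun setT (fun w => Z w ord0 i)) /\
  forall s : 'rV[R]_m,
    'E_P[fun w => cos (\sum_(i < m) s ord0 i * Z w ord0 i)]%E
      = (expR (- (2^-1 * \sum_(i < m) \sum_(j < m)
                  s ord0 i * s ord0 j * S i j)))%:E
    /\ 'E_P[fun w => sin (\sum_(i < m) s ord0 i * Z w ord0 i)]%E = 0%E.

(* Main.v *)
Require Import Defs.
From HB Require Import structures.
From mathcomp Require Import all_boot all_order all_algebra.
From mathcomp Require Import all_classical all_reals all_analysis.
From mathcomp Require Import measurable_realfun ring lra zify.
Set Implicit Arguments. Unset Strict Implicit. Unset Printing Implicit Defensive.
Import Order.TTheory GRing.Theory Num.Theory.
Import numFieldNormedType.Exports.
Local Open Scope classical_set_scope.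
Local Open Scope ring_scope.

(** Grow the tree vertex by vertex, write D_i for the depth of vertex i, H for
   the harmonic number H_n and h_i = H_n - H_i. A vertex of depth d present at
   time i contributes about h_i^(k-d)/(k-d)! to X_n(k) on average, and
   telescoping the sum of these contributions over i decomposes X_n(k) as
   H^k/k!, plus martingale increments, minus a nonnegative drift which is
   negligible in L1. In the i-th increment the event D_i = 1 has the weight
   h_i^(k-1)/(k-1)!; the part coming from D_i >= 2 is negligible in L2, because
   P(D_i = d+1) <= (H_i^d/d!)/i and the sum over d of the resulting variances is
   a binomial expansion. Up to o(1), the normalized X_n(k) is thus a weighted
   sum of the centered independent events "i is a child of the root" with
   weights proportional to (h_i/H)^(k-1); the covariances of these sums for two
   levels are Riemann sums of the integral of x^(k+k'-2), whence the limit
   1/(u+v), and their characteristic functions converge by Lindeberg's argument.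
   Convergence of characteristic functions gives weak convergence: f(x) is
   approximated by f(a sin(x/a)) for large a, which is uniformly close to a
   trigonometric polynomial by Bernstein's theorem. *)

(** * Resampling one parent in a uniform recursive tree *)

Section RecursiveTrees.
Context {R : realType} {n : nat}.
Implicit Types (t : rtree_code n) (F G : rtree_code n -> R).

Lemma rrt_expect_sum (I : Type) (r : seq I) (P : pred I)
    (F : I -> rtree_code n -> R) :
  rrt_expect (fun t => \sum_(i <- r | P i) F i t)
    = \sum_(i <- r | P i) rrt_expect (F i).
Proof. by rewrite /rrt_expect exchange_big mulr_sumr. Qed.

Lemma rrt_expectD F G :
  rrt_expect (fun t => F t + G t) = rrt_expect F + rrt_expect G.
Proof. by rewrite /rrt_expect big_split mulrDr. Qed.

Lemma rrt_expectZ (a : R) F :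
  rrt_expect (fun t => a * F t) = a * rrt_expect F.
Proof. by rewrite /rrt_expect -mulr_sumr mulrCA. Qed.

Lemma rrt_expectB F G :
  rrt_expect (fun t => F t - G t) = rrt_expect F - rrt_expect G.
Proof.
rewrite -mulN1r -rrt_expectZ -rrt_expectD.
by rewrite /rrt_expect; under [in RHS]eq_bigr do rewrite mulN1r.
Qed.

Lemma rrt_expect_le F G :
  (forall t, t \in rec_trees n -> F t <= G t) -> rrt_expect F <= rrt_expect G.
Proof.
by move=> FG; rewrite /rrt_expect ler_wpM2l ?invr_ge0 ?ler0n// ler_sum.
Qed.

Lemma eq_rrt_expect F G :
  (forall t, t \in rec_trees n -> F t = G t) -> rrt_expect F = rrt_expect G.
Proof. by move=> FG; rewrite /rrt_expect; congr (_ * _); exact: eq_bigr. Qed.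

Lemma card_rec_trees_gt0 : (0 < #|rec_trees n|)%N.
Proof.
apply/card_gt0P; exists [ffun=> ord0]; rewrite inE.
by apply/forallP => i; rewrite ffunE.
Qed.

Lemma rrt_expect_cst (c : R) : rrt_expect (fun _ : rtree_code n => c) = c.
Proof.
rewrite /rrt_expect sumr_const -[c *+ _]mulr_natl mulKf//.
by rewrite pnatr_eq0 -lt0n card_rec_trees_gt0.
Qed.

Lemma rrt_expect_norm F : `|rrt_expect F| <= rrt_expect (fun t => `|F t|).
Proof.
rewrite /rrt_expect normrM ger0_norm ?invr_ge0 ?ler0n//.
by rewrite ler_wpM2l ?invr_ge0 ?ler0n// ler_norm_sum.
Qed.

Lemma rrt_expect_ge0 F :
  (forall t, t \in rec_trees n -> 0 <= F t) -> 0 <= rrt_expect F.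
Proof. by move=> F0; rewrite -(rrt_expect_cst 0) rrt_expect_le. Qed.

Definition set_parent t (i : 'I_n) (j : 'I_n.+1) : rtree_code n :=
  [ffun x => if x == i then j else t x].

Lemma rec_treesP t :
  reflect (forall i : 'I_n, (t i <= i)%N) (t \in rec_trees n).
Proof. by rewrite inE; exact: forallP. Qed.

Lemma set_parent_rec t (i : 'I_n) (j : 'I_n.+1) :
  t \in rec_trees n -> (j <= i)%N -> set_parent t i j \in rec_trees n.
Proof.
move=> /rec_treesP tr ji; apply/rec_treesP => x; rewrite ffunE.
by case: eqP => [->|].
Qed.

(* Reindex by the involution [(t, j) |-> (set_parent t i j, t i)]. *)
Lemma rrt_resample (i : 'I_n) F :
  rrt_expect F =
  rrt_expect (fun t => i.+1%:R^-1 * \sum_(j < n.+1 | (j <= i)%N) F (set_parent t i j)).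
Proof.
rewrite rrt_expectZ.
suff -> : rrt_expect (fun t => \sum_(j < n.+1 | (j <= i)%N) F (set_parent t i j))
    = i.+1%:R * rrt_expect F by rewrite mulKf// pnatr_eq0.
rewrite -rrt_expectZ /rrt_expect; congr (_ * _).
rewrite pair_big /=.
pose tau (p : rtree_code n * 'I_n.+1) := (set_parent p.1 i p.2, p.1 i).
have tauK : cancel tau tau.
  case=> t j; rewrite /tau /= !ffunE eqxx; congr pair.
  by apply/ffunP => x; rewrite !ffunE; case: eqP => [->|].
rewrite (reindex_inj (can_inj tauK)) /=.
transitivity (\sum_(p : rtree_code n * 'I_n.+1 | (p.1 \in rec_trees n) && (p.2 <=
  i)%N) F p.1).
  apply: eq_big => -[t j] /=.
    apply/andP/andP => -[tr ji]; last first.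
      by split; [exact: set_parent_rec | move/rec_treesP : tr].
    have /rec_treesP := tr => /(_ i); rewrite ffunE eqxx => ji'; split => //.
    rewrite (_ : t = set_parent (set_parent t i j) i (t i)); last first.
      by apply/ffunP => x; rewrite !ffunE; case: eqP => [->|].
    exact: set_parent_rec.
  move=> _; congr F; apply/ffunP => x; rewrite !ffunE.
  by case: eqP => [->|].
rewrite -(pair_big (fun t => t \in rec_trees n) (fun j : 'I_n.+1 => (j <= i)%N)
  (fun t _ => F t)) /=.
apply: eq_bigr => t _; rewrite sumr_const -[LHS]mulr_natl; congr (_%:R * _).
have : (\sum_(j < i.+1) 1 = \sum_(j < n.+1 | j <= i) 1)%N.
  by apply: (big_ord_widen n.+1 (fun=> 1%N)); apply: leqW.
by rewrite big_const_ord iter_addn_0 mul1n sum1dep_card cardsE => <-.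
Qed.

Lemma rparent_lt t j : t \in rec_trees n -> (rparent t j <= j)%N.
Proof.
move=> /rec_treesP tr; rewrite /rparent; case: insubP => //= i _ <-; exact: tr.
Qed.

Lemma rdepth_fuelE t (f j : nat) : t \in rec_trees n -> (j <= f)%N ->
  rdepth_fuel t f j = rdepth t j.
Proof.
move=> tr; rewrite /rdepth.
suff H : forall m f f' j, (j <= m -> j <= f -> j <= f' ->
    rdepth_fuel t f j = rdepth_fuel t f' j)%N.
  by move=> jf; apply: (H j).
elim=> [|m IH] {}f f' [|{}j] //=; first by case: f f' => [|f] [|f'].
  by case: f f' => [|f] [|f'].
case: f f' => [//|f] [//|f'] jm jf jf' /=; congr S.
by apply: IH; exact: leq_trans (rparent_lt j tr) _.
Qed.

Lemma rdepthS t j : t \in rec_trees n ->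
  rdepth t j.+1 = (rdepth t (rparent t j)).+1.
Proof. by move=> tr; rewrite {1}/rdepth /= rdepth_fuelE// rparent_lt. Qed.

Lemma rdepth0 t : rdepth t 0 = 0%N. Proof. by []. Qed.

Lemma rdepth_eq0 t j : (rdepth t j == 0%N) = (j == 0%N).
Proof. by case: j. Qed.

Lemma rparent_set t (i : 'I_n) (j : 'I_n.+1) v :
  rparent (set_parent t i j) v = if v == i then j : nat else rparent t v.
Proof.
rewrite /rparent; case: insubP => [w _ wv|]; first by rewrite ffunE -wv (inj_eq
  val_inj); case: ifP.
by case: eqP => // ->; rewrite ltn_ord.
Qed.

Lemma rdepth_set t (i : 'I_n) (j : 'I_n.+1) v :
  t \in rec_trees n -> (j <= i)%N -> (v <= i)%N ->
  rdepth (set_parent t i j) v = rdepth t v.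
Proof.
move=> tr ji; have tr' := set_parent_rec tr ji.
elim/ltn_ind: v => -[//|v] IH vi; rewrite !rdepthS// rparent_set ltn_eqF//.
by rewrite IH// ?ltnS ?rparent_lt// (leq_trans (rparent_lt v tr))// ltnW.
Qed.

Lemma rdepth_set_child t (i : 'I_n) (j : 'I_n.+1) :
  t \in rec_trees n -> (j <= i)%N ->
  rdepth (set_parent t i j) i.+1 = (rdepth t j).+1.
Proof.
move=> tr ji; rewrite rdepthS ?set_parent_rec// rparent_set eqxx.
by rewrite rdepth_set.
Qed.

(** Given the depths of the vertices up to i, the parent of vertex i+1 is uniform on 0..i:
    resampling it changes no earlier depth, so [A], which sees only those, is left untouched. *)
Lemma rrt_expect_next (i : nat) (A : (nat -> nat) -> R) (g : nat -> R) :
  (i < n)%N ->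
  (forall D D', (forall v, (v <= i)%N -> D v = D' v) -> A D = A D') ->
  rrt_expect (fun t => A (@rdepth n t) * g (rdepth t i.+1)) =
  rrt_expect (fun t => A (@rdepth n t) *
    (i.+1%:R^-1 * \sum_(0 <= j < i.+1) g (rdepth t j).+1)).
Proof.
move=> ni loc; pose i' := Ordinal ni.
rewrite (rrt_resample i'); apply: eq_rrt_expect => t tr.
rewrite mulrCA; congr (_ * _); rewrite big_mkord.
rewrite (big_ord_widen n.+1 (fun j => g (rdepth t j).+1))//; last exact: ltnW.
rewrite mulr_sumr; apply: eq_bigr => j ji.
rewrite (rdepth_set_child (i := i')) //; congr (_ * _).
by apply: loc => v vi; apply: rdepth_set.
Qed.

End RecursiveTrees.

(** * Harmonic numbers, divided powers and occupancy of the levels *)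

Section DividedPowers.
Context {R : realType}.
Implicit Types (x y z : R) (d k r s : nat).

Definition dpow r x : R := x ^+ r / r`!%:R.

(** The guard matters: by truncated subtraction a vertex deeper than k would otherwise get the value
    1. In x, the derivative of [cdpow k d] is [cdpow k d.+1]. *)
Definition cdpow k d x : R := if (d <= k)%N then dpow (k - d) x else 0.

Lemma dpow_ge0 r x : 0 <= x -> 0 <= dpow r x.
Proof. by move=> x0; rewrite divr_ge0 ?exprn_ge0. Qed.

Lemma cdpow_ge0 k d x : 0 <= x -> 0 <= cdpow k d x.
Proof. by move=> x0; rewrite /cdpow; case: ifP => // _; exact: dpow_ge0. Qed.

Lemma dpow0 x : dpow 0 x = 1.
Proof. by rewrite /dpow expr0 fact0 divr1. Qed.

Lemma cdpow_at0 k d : cdpow k d 0 = (d == k)%:R.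
Proof.
rewrite /cdpow; case: ltngtP => [dk|//|->]; last by rewrite subnn dpow0.
by rewrite /dpow expr0n subn_eq0 leqNgt dk mul0r.
Qed.

Lemma exprD_ge_linear s x y : 0 <= x -> 0 <= y ->
  x ^+ s.+1 + s.+1%:R * y * x ^+ s <= (x + y) ^+ s.+1.
Proof.
move=> x0 y0; elim: s => [|s IH]; first by rewrite !expr1 expr0 mulr1 mul1r.
rewrite (exprS (x + y)); apply: le_trans (ler_wpM2l (addr_ge0 x0 y0) IH).
rewrite !exprS -!natr1.
have : 0 <= y * y * x ^+ s * (s%:R + 1).
  by rewrite !mulr_ge0 ?exprn_ge0 ?addr_ge0 ?ler0n ?ler01.
set X := x ^+ s; set S := s%:R; nra.
Qed.

(** Taylor's formula at order two, with the remainder taken at the right end [x + y] and its factor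
    1/2 given away. *)
Lemma exprD_le_quadratic s x y : 0 <= x -> 0 <= y ->
  (x + y) ^+ s.+2 <= x ^+ s.+2 + s.+2%:R * y * x ^+ s.+1
     + s.+2%:R * s.+1%:R * y ^+ 2 * (x + y) ^+ s.
Proof.
move=> x0 y0; have xy0 := addr_ge0 x0 y0.
elim: s => [|s IH]; first by rewrite !expr0 expr1; nra.
rewrite (exprS (x + y) s.+2); apply: le_trans (ler_wpM2l xy0 IH) _.
have xz : x ^+ s <= (x + y) ^+ s by rewrite lerXn2r ?nnegrE ?lerDl.
have S0 : 0 <= s%:R + 1 + 1 :> R by have := ler0n R s; lra.
have : 0 <= y ^+ 2 * x * ((x + y) ^+ s - x ^+ s) * (s%:R + 1 + 1).
  by rewrite !mulr_ge0 ?exprn_ge0 ?subr_ge0.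
have : 0 <= y ^+ 2 * y * (x + y) ^+ s * (s%:R + 1 + 1).
  by rewrite !mulr_ge0 ?exprn_ge0.
have : 0 <= y ^+ 2 * (x + y) * (x + y) ^+ s * (s%:R + 1 + 1).
  by rewrite !mulr_ge0 ?exprn_ge0.
rewrite !exprS -!natr1 expr0.
set X := x ^+ s; set Z := (x + y) ^+ s; set S := s%:R; nra.
Qed.

Lemma dpowD_ge_linear r x y : 0 <= x -> 0 <= y ->
  dpow r.+1 x + y * dpow r x <= dpow r.+1 (x + y).
Proof.
move=> x0 y0; rewrite /dpow factS natrM.
have f0 : (r`!%:R : R) != 0 by rewrite pnatr_eq0 -lt0n fact_gt0.
have s0 : (r.+1%:R : R) != 0 by rewrite pnatr_eq0.
rewrite [leLHS](_ : _ = (x ^+ r.+1 + r.+1%:R * y * x ^+ r) / (r.+1%:R * r`!%:R));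
  last first.
  by move: (r.+1%:R : R) s0 => a s0; field; rewrite f0 s0.
by rewrite ler_wpM2r ?exprD_ge_linear// invr_ge0 mulr_ge0 ?ler0n.
Qed.

Lemma dpowD_le_quadratic r x y : 0 <= x -> 0 <= y ->
  dpow r.+2 (x + y) <= dpow r.+2 x + y * dpow r.+1 x + y ^+ 2 * dpow r (x + y).
Proof.
move=> x0 y0; rewrite /dpow !factS !natrM.
have f0 : (r`!%:R : R) != 0 by rewrite pnatr_eq0 -lt0n fact_gt0.
have s0 : (r.+1%:R : R) != 0 by rewrite pnatr_eq0.
have t0 : (r.+2%:R : R) != 0 by rewrite pnatr_eq0.
rewrite [leRHS](_ : _ = (x ^+ r.+2 + r.+2%:R * y * x ^+ r.+1
     + r.+2%:R * r.+1%:R * y ^+ 2 * (x + y) ^+ r) / (r.+2%:R * (r.+1%:R *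
         r`!%:R))); last first.
  move: (r.+1%:R : R) (r.+2%:R : R) s0 t0 => a b s0 t0.
  by field; rewrite f0 s0 t0.
by rewrite ler_wpM2r ?exprD_le_quadratic// invr_ge0 !mulr_ge0 ?ler0n.
Qed.

Lemma cdpowD_ge_linear k d x y : 0 <= x -> 0 <= y ->
  cdpow k d x + y * cdpow k d.+1 x <= cdpow k d (x + y).
Proof.
move=> x0 y0; rewrite /cdpow; case: ltngtP => [dk|dk|->].
- by rewrite subnS -(@prednK (k - d)) ?subn_gt0 //; exact: dpowD_ge_linear.
- by rewrite mulr0 addr0.
- by rewrite subnn !dpow0 mulr0 addr0.
Qed.

Lemma cdpowD_le_quadratic k d x y : 0 <= x -> 0 <= y ->
  cdpow k d (x + y) <=
  cdpow k d x + y * cdpow k d.+1 x + y ^+ 2 * cdpow k d.+2 (x + y).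
Proof.
move=> x0 y0; rewrite /cdpow.
have [dk|kd] := leqP d k; last by rewrite !ltnNge (leqW (ltnW kd)) (ltnW kd) /=
  !mulr0 !addr0.
rewrite -(subnKC dk) !ltnNge; move: (k - d)%N => r {dk}.
case: r => [|[|r]].
- by rewrite addn0 leqnn leqW //= subnn !dpow0 !mulr0 !addr0.
- rewrite addn1 ltnn leqnn /= subnn mulr0 addr0 dpow0 subSnn /dpow !expr1 factS
    fact0 muln1 !divr1; lra.
- have -> : (d + r.+2 <= d)%N = false by apply/negbTE; lia.
  have -> : (d + r.+2 <= d.+1)%N = false by apply/negbTE; lia.
  have -> : (d + r.+2 - d = r.+2)%N by lia.
  have -> : (d + r.+2 - d.+1 = r.+1)%N by lia.
  have -> : (d + r.+2 - d.+2 = r)%N by lia.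
  exact: dpowD_le_quadratic.
Qed.

(** The binomial theorem divided by r!. It recombines H_i and h_i into H when contributions are
    summed over depths. *)
Lemma dpowD r x y : \sum_(d < r.+1) dpow d y * dpow (r - d) x = dpow r (x + y).
Proof.
rewrite /dpow exprDn mulr_suml; apply: eq_bigr => -[d /= dr] _.
have f0 s : (s`!%:R : R) != 0 by rewrite pnatr_eq0 -lt0n fact_gt0.
rewrite -mulr_natl.
have := bin_fact (dr : (d <= r)%N) => /(congr1 (fun i => i%:R : R)).
rewrite !natrM => <-.
have b0 : ('C(r, d)%:R : R) != 0 by rewrite pnatr_eq0 -lt0n bin_gt0 -ltnS.
by field; rewrite ?f0 ?b0.
Qed.

End DividedPowers.

Section Harmonic.
Context {R : realType}.

Definition hsum (m : nat) : R := \sum_(0 <= j < m) j.+1%:R^-1.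

Lemma hsum0 : hsum 0 = 0. Proof. by rewrite /hsum big_geq. Qed.

Lemma hsumS m : hsum m.+1 = hsum m + m.+1%:R^-1.
Proof. by rewrite /hsum big_nat_recr. Qed.

Lemma hsum_ge0 m : 0 <= hsum m.
Proof. by rewrite /hsum sumr_ge0// => j _; rewrite invr_ge0. Qed.

Lemma hsum_le : {homo hsum : m m' / (m <= m')%N >-> m <= m'}.
Proof.
apply: homo_leq => //; first exact: le_trans.
by move=> m; rewrite hsumS lerDl invr_ge0.
Qed.

Lemma hsum_gt0 m : (0 < m)%N -> 0 < hsum m.
Proof.
case: m => // m _; apply: lt_le_trans (hsum_le (ltn0Sn m)).
by rewrite hsumS hsum0 add0r invr_gt0.
Qed.

Lemma sum_inv_sq_le n : \sum_(0 <= i < n) (i.+1%:R^-1) ^+ 2 <= 2 :> R.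
Proof.
case: n => [|n]; first by rewrite big_geq.
(* The sharper bound passes through the induction because 1/(n+2)^2 <= 1/(n+1) - 1/(n+2). *)
suff : \sum_(0 <= i < n.+1) (i.+1%:R^-1) ^+ 2 <= 2 - n.+1%:R^-1 :> R.
  by move/le_trans; apply; rewrite gerBl invr_ge0.
elim: n => [|n IH]; first by rewrite big_nat1 invr1; lra.
rewrite big_nat_recr//=; apply: le_trans (lerD IH (lexx _)) _.
have a0 : 0 < n.+1%:R :> R by [].
rewrite -[n.+2%:R]natr1; move: (n.+1%:R : R) a0 => a a0.
rewrite -subr_ge0 (_ : _ - _ = a^-1 * (a + 1)^-1 ^+ 2); last first.
  by field; rewrite !gt_eqF// addr_gt0.
by rewrite mulr_ge0 ?exprn_ge0 ?invr_ge0 ?addr_ge0// ltW.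
Qed.

End Harmonic.

Section Occupancy.
Context {R : realType} {n : nat}.
Local Notation E := (@rrt_expect R n).

Lemma sum_depth_fiber (g : nat -> R) (B : nat) (m : nat) (D : nat -> nat) :
  (forall d, (B <= d)%N -> g d = 0) ->
  \sum_(0 <= j < m) g (D j)
    = \sum_(d < B) g d * \sum_(0 <= j < m) (D j == d)%:R.
Proof.
move=> gB; under [RHS]eq_bigr do rewrite mulr_sumr.
rewrite exchange_big /=; apply: eq_bigr => j _.
have [DB|BD] := ltnP (D j) B.
  rewrite (bigD1 (Ordinal DB))//= eqxx mulr1 big1 ?addr0// => d /eqP dB.
  by case: eqP => [Dd|]; [case: dB; apply/val_inj | rewrite mulr0].
rewrite gB// big1// => -[d /= dB] _; case: eqP => [Dd|]; last by rewrite mulr0.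
by move: BD; rewrite Dd leqNgt dB.
Qed.

(** Vertex M+1 has depth d+1 with conditional probability 1/(M+1) times the current number of
    vertices at depth d. The induction closes because the first two binomial terms of (H_M +
    1/(M+1))^(d+1) already dominate the sum. *)
Lemma occupancy_le (M d : nat) : (M <= n)%N ->
  E (fun t => \sum_(0 <= j < M.+1) (rdepth t j == d)%:R) <= dpow d (hsum M).
Proof.
elim: M d => [|M IH] d Mn.
  under eq_rrt_expect do rewrite big_nat1 rdepth0.
  rewrite rrt_expect_cst hsum0; case: d => [|d]; first by rewrite dpow0.
  by rewrite dpow_ge0.
under eq_rrt_expect do rewrite big_nat_recr//=.
rewrite rrt_expectD.
have := rrt_expect_next (R := R) (A := fun=> 1) (fun e => (e == d)%:R) Mn
  (fun _ _ _ => erefl).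
under eq_rrt_expect do rewrite mul1r.
move=> ->; under [X in _ + X]eq_rrt_expect do rewrite mul1r.
rewrite rrt_expectZ hsumS.
have MM := IH _ (ltnW Mn).
case: d => [|d].
  (* Only the root has depth 0, so the new vertex adds nothing here. *)
  rewrite [X in _ * X](_ : _ = 0) ?mulr0 ?addr0; last first.
    by rewrite -[RHS](rrt_expect_cst (n := n)); apply: eq_rrt_expect => t _;
      rewrite big1.
  by apply: le_trans (MM _) _; rewrite !dpow0.
apply: le_trans (dpowD_ge_linear _ _ _); rewrite ?hsum_ge0 ?invr_ge0//.
apply: lerD => //; rewrite ler_wpM2l ?invr_ge0//.
by under eq_rrt_expect do under eq_bigr do rewrite eqSS.
Qed.

Lemma expect_sum_depth_le (g : nat -> R) (B M : nat) : (M <= n)%N ->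
  (forall d, 0 <= g d) -> (forall d, (B <= d)%N -> g d = 0) ->
  E (fun t => \sum_(0 <= j < M.+1) g (rdepth t j))
    <= \sum_(d < B) g d * dpow d (hsum M).
Proof.
move=> Mn g0 gB.
under eq_rrt_expect do rewrite (sum_depth_fiber _ _ gB).
rewrite rrt_expect_sum; apply: ler_sum => d _.
by rewrite rrt_expectZ ler_wpM2l// occupancy_le.
Qed.

End Occupancy.

(** * Martingale increments along the growth of the tree *)

Section Decomposition.
Context {R : realType} {n : nat}.
Local Notation E := (@rrt_expect R n).
Implicit Types (g : nat -> R) (D : nat -> nat).

Definition hrest (m : nat) : R := hsum n - hsum m.

(** The parent of vertex i+1 being uniform on 0..i, the subtracted average is the conditional mean
    of [g (D i.+1)] given the earlier depths; [noise] is thus a martingale increment. *)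
Definition noise g i D : R :=
  g (D i.+1) - i.+1%:R^-1 * \sum_(0 <= j < i.+1) g (D j).+1.

Lemma hrest_ge0 m : (m <= n)%N -> 0 <= hrest m.
Proof. by move=> mn; rewrite subr_ge0 hsum_le. Qed.

Lemma hrestS m : hrest m = hrest m.+1 + m.+1%:R^-1.
Proof. by rewrite /hrest hsumS opprD addrA subrK. Qed.

Lemma noise_local g i D D' : (forall v, (v <= i.+1)%N -> D v = D' v) ->
  noise g i D = noise g i D'.
Proof.
move=> DD; rewrite /noise DD//; congr (_ - _ * _).
by apply: eq_big_nat => j /andP[_ ji]; rewrite DD// ltnW.
Qed.

Lemma noise_orthogonal g i (A : (nat -> nat) -> R) : (i < n)%N ->
  (forall D D', (forall v, (v <= i)%N -> D v = D' v) -> A D = A D') ->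
  E (fun t => A (rdepth t) * noise g i (rdepth t)) = 0.
Proof.
move=> ni loc; under eq_rrt_expect do rewrite mulrBr.
by rewrite rrt_expectB (rrt_expect_next _ ni loc) subrr.
Qed.

Lemma noise_second_moment g i : (i < n)%N ->
  E (fun t => noise g i (rdepth t) ^+ 2) <= E (fun t => g (rdepth t i.+1) ^+ 2).
Proof.
move=> ni; pose c D : R := i.+1%:R^-1 * \sum_(0 <= j < i.+1) g (D j).+1.
have loc D D' : (forall v, (v <= i)%N -> D v = D' v) -> c D = c D'.
  by move=> DD; congr (_ * _); apply: eq_big_nat => j /andP[_ ji]; rewrite DD.
have H := rrt_expect_next g ni loc.
rewrite -subr_ge0 -rrt_expectB.
(* With X the value at the new vertex and c its conditional mean, the gap is E(2cX - c^2), and E(cX)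
   = E(c^2) leaves E(c^2) >= 0. *)
rewrite [leRHS](_ : _ = E (fun t => 2 * (c (rdepth t) * g (rdepth t i.+1))
    - c (rdepth t) * c (rdepth t))); last first.
  by apply: eq_rrt_expect => t _; rewrite /noise -/(c _); ring.
rewrite rrt_expectB rrt_expectZ H -[X in 2 * X]/(E (fun t => c (rdepth t) * c
  (rdepth t))).
rewrite mulr2n mulrDl mul1r addrK; apply: rrt_expect_ge0 => t _.
by rewrite -expr2 sqr_ge0.
Qed.

(** The increments are orthogonal: the sum of the earlier ones depends on earlier depths only, so
    the cross term with the new one vanishes. *)
Lemma noise_sum_second_moment (g : nat -> nat -> R) (N : nat) : (N <= n)%N ->
  E (fun t => (\sum_(0 <= i < N) noise (g i) i (rdepth t)) ^+ 2)
  <= \sum_(0 <= i < N) E (fun t => g i (rdepth t i.+1) ^+ 2).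
Proof.
elim: N => [|N IH] Nn.
  by under eq_rrt_expect do rewrite big_geq// expr0n; rewrite rrt_expect_cst big_geq.
under eq_rrt_expect do rewrite big_nat_recr//= sqrrD.
rewrite big_nat_recr//= !rrt_expectD; apply: lerD; last exact: noise_second_moment.
rewrite [X in _ + X](_ : _ = 0) ?addr0; first exact/IH/ltnW.
have noise0 := noise_orthogonal (g N)
  (A := fun D => \sum_(0 <= i < N) noise (g i) i D) Nn.
rewrite noise0 ?addr0// => D D' DD.
apply: eq_big_nat => i /andP[_ iN]; apply: noise_local => v vi; apply: DD.
exact: leq_trans vi iN.
Qed.

(** Vertex i+1 has depth d+1 with probability at most [dpow d (hsum i)] divided by i+1, by the
    occupancy bound. *)
Lemma expect_sq_depth g i (B : nat) : (i < n)%N ->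
  (forall d, (B <= d)%N -> g d.+1 = 0) ->
  E (fun t => g (rdepth t i.+1) ^+ 2)
    <= i.+1%:R^-1 * \sum_(d < B) g d.+1 ^+ 2 * dpow d (hsum i).
Proof.
move=> ni gB.
have := rrt_expect_next (R := R) (A := fun=> 1) (fun e => g e ^+ 2) ni
  (fun _ _ _ => erefl).
under eq_rrt_expect do rewrite mul1r.
move=> ->; under eq_rrt_expect do rewrite mul1r.
rewrite rrt_expectZ ler_wpM2l ?invr_ge0//.
apply: (expect_sum_depth_le (g := fun d => g d.+1 ^+ 2)); first exact: ltnW.
  by move=> d; rewrite sqr_ge0.
by move=> d Bd; rewrite gB// expr0n.
Qed.

End Decomposition.

(** * Estimates for the variance of the deep part *)

Section RemainderBound.
Context {R : realType}.

(** A lower Riemann sum, with steps 1/(i+1), of the integral of exp(-cx); the proof compares it with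
    the exact integral up to H_n, so that the bound is uniform in n. *)
Lemma sum_exp_hsum_le (n : nat) (c : R) : 0 < c ->
  \sum_(0 <= i < n) i.+1%:R^-1 * expR (- (c * hsum i.+1)) <= c^-1.
Proof.
move=> c0.
suff : \sum_(0 <= i < n) i.+1%:R^-1 * expR (- (c * hsum i.+1))
    <= c^-1 * (1 - expR (- (c * hsum n))).
  by move/le_trans; apply; apply: ler_piMr; rewrite ?gerBl ?expR_ge0// invr_ge0 ltW.
elim: n => [|n IH]; first by rewrite big_geq// hsum0 mulr0 oppr0 expR0 subrr mulr0.
rewrite big_nat_recr//=; apply: le_trans (lerD IH (lexx _)) _.
rewrite -subr_ge0 (_ : _ - _ = c^-1 * (expR (- (c * hsum n))
   - (1 + c * n.+1%:R^-1) * expR (- (c * hsum n.+1)))); last first.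
  by move: (n.+1%:R^-1 : R) => a; field; rewrite gt_eqF.
apply: mulr_ge0; first by rewrite invr_ge0 ltW.
rewrite subr_ge0.
rewrite (_ : - (c * hsum n) = c * n.+1%:R^-1 + - (c * hsum n.+1)); last first.
  by rewrite hsumS; ring.
by rewrite expRD ler_wpM2r ?expR_ge0// expR_ge1Dx.
Qed.

Lemma subrX_le (K : nat) (y z : R) : 0 <= z -> z <= y ->
  y ^+ K.+1 - z ^+ K.+1 <= K.+1%:R * (y - z) * y ^+ K.
Proof.
move=> z0 zy; have y0 := le_trans z0 zy.
elim: K => [|K IH]; first by rewrite !expr1 expr0 mulr1 mul1r.
rewrite (_ : y ^+ K.+2 - z ^+ K.+2 = y * (y ^+ K.+1 - z ^+ K.+1) + z ^+ K.+1 * (y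
  - z)); last first.
  by rewrite !exprS; ring.
apply: le_trans (lerD (ler_wpM2l y0 IH) (lexx _)) _.
have : 0 <= (y ^+ K.+1 - z ^+ K.+1) * (y - z).
  by rewrite mulr_ge0 ?subr_ge0// lerXn2r.
by rewrite !exprS -!natr1; set S := K%:R; set Y := y ^+ K; set Z := z ^+ K; nra.
Qed.

(** After simplification the d-th term on the left is the d-th binomial term on the right, with the
    falling factorial K(K-1)...(K-d+1) in place of K^d. The subtracted power is the missing term d =
    0. *)
Lemma remainder_term (K : nat) (H s : R) : 0 < H -> 0 <= s -> s <= 1 ->
  (K`!%:R / H ^+ K) ^+ 2 *
    \sum_(1 <= d < K.+1) dpow (K - d) ((1 - s) * H) ^+ 2 * dpow d (s * H)
  <= (K%:R / H * s + (1 - s) ^+ 2) ^+ K - ((1 - s) ^+ 2) ^+ K.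
Proof.
move=> H0 s0 s1; have x0 : 0 <= 1 - s by rewrite subr_ge0.
rewrite [X in X ^+ K - _]addrC exprDn -(big_mkord predT (fun d => ((1 - s) ^+ 2)
  ^+ (K - d) * (K%:R / H * s) ^+ d *+ 'C(K, d))).
rewrite [in leRHS]big_nat_recl//= subn0 expr0 mulr1 bin0 mulr1n [leRHS]addrC
  addrA addNr add0r.
rewrite big_add1 /= mulr_sumr !big_nat; apply: ler_sum => d /andP[_ dK].
have f0 r : (r`!%:R : R) != 0 by rewrite pnatr_eq0 -lt0n fact_gt0.
have dK' : (d.+1 <= K)%N by [].
have bf : (K`!%:R : R) = 'C(K, d.+1)%:R * (d.+1`!%:R * (K - d.+1)`!%:R).
  by rewrite -!natrM bin_fact.
have ff : (K ^_ d.+1)%:R * (K - d.+1)`!%:R = K`!%:R :> R by rewrite -natrM ffact_fact.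
have HK : H ^+ K = H ^+ d.+1 * H ^+ (K - d.+1) by rewrite -exprD subnKC.
rewrite [leLHS](_ : _ = 'C(K, d.+1)%:R * (1 - s) ^+ 2 ^+ (K - d.+1) * s ^+ d.+1 /
  H ^+ d.+1 * (K ^_ d.+1)%:R); last first.
  rewrite /dpow (exprAC (1 - s)) [_`!%:R / _]lock expr2 -lock {1}bf -ff HK.
  rewrite (exprMn (K - d.+1)) (exprMn d.+1).
  have h1 : H ^+ d.+1 != 0 by rewrite expf_neq0 ?gt_eqF.
  have h2 : H ^+ (K - d.+1) != 0 by rewrite expf_neq0 ?gt_eqF.
  move: h1 h2 (f0 d.+1) (f0 (K - d.+1)%N).
  move: (H ^+ d.+1) (H ^+ (K - d.+1)) (s ^+ d.+1) => h1 h2 S hh1 hh2.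
  move: (d.+1`!%:R : R) ((K - d.+1)`!%:R : R) => f1 f2 ff1 ff2.
  move: ((K ^_ d.+1)%:R : R) ('C(K, d.+1)%:R : R) ((1 - s) ^+ (K - d.+1)) => u v w.
  by field; rewrite hh1 hh2 ff1 ff2.
rewrite [leRHS](_ : _ = 'C(K, d.+1)%:R * (1 - s) ^+ 2 ^+ (K - d.+1) * s ^+ d.+1 /
  H ^+ d.+1 * (K%:R ^+ d.+1)); last first.
  rewrite -[LHS]mulr_natl !exprMn exprVn.
  by ring.
rewrite ler_wpM2l//.
  by rewrite divr_ge0 ?mulr_ge0 ?exprn_ge0// ltW.
rewrite -natrX ler_nat {bf ff HK f0 dK dK'}.
elim: d.+1 => [|m IH]; first by rewrite ffactn0 expn0.
by rewrite ffactnSr expnSr leq_mul// leq_subr.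
Qed.

(** The difference of powers is at most K e s y^(K-1), where e = K/H and y = e s + (1-s)^2. Since e
    <= 1/2, y <= exp(-s/2); half of the resulting exponential decay absorbs the factor K s. *)
Lemma remainder_term_exp (K : nat) (H s : R) : (2 <= K)%N -> 0 < H ->
  K%:R / H <= 2^-1 -> 0 <= s -> s <= 1 ->
  (K%:R / H * s + (1 - s) ^+ 2) ^+ K - ((1 - s) ^+ 2) ^+ K
  <= 8 * (K%:R / H) * expR (- (K%:R / 8 * s)).
Proof.
move=> K2 H0 e2 s0 s1; have e0 : 0 <= K%:R / H by rewrite divr_ge0// ltW.
move: (K%:R / H) e0 e2 => e e0 e2.
case: K K2 => // K; rewrite ltnS => K1.
apply: le_trans (subrX_le _ _ _) _; [exact: sqr_ge0|by rewrite lerDr mulr_ge0|].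
rewrite addrK.
have b1 : e * s + (1 - s) ^+ 2 <= expR (- (s / 2)).
  by apply: le_trans (expR_ge1Dx _); nra.
(* [K] is now one less than in the statement; K >= 1 gives K/2 >= 2 (K+1)/8, hence two copies of the
   exponential, one of which is used up by z exp(-z) <= 1. *)
have b2 : (e * s + (1 - s) ^+ 2) ^+ K <= expR (- (K.+1%:R / 8 * s)) ^+ 2.
  apply: le_trans (_ : expR (- (s / 2)) ^+ K <= _).
    by rewrite lerXn2r ?nnegrE ?expR_ge0 ?addr_ge0 ?sqr_ge0 ?mulr_ge0.
  rewrite -!expRM_natl ler_expR -[K.+1%:R]natr1.
  have : 1 <= K%:R :> R by rewrite ler1n.
  by nra.
apply: le_trans (ler_wpM2l _ b2) _; first by rewrite !mulr_ge0.
set z := K.+1%:R / 8 * s.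
rewrite [leLHS](_ : _ = 8 * e * expR (- z) * (z * expR (- z))); last first.
  by rewrite /z; field.
rewrite ler_piMr ?mulr_ge0 ?expR_ge0//.
rewrite expRN ler_pdivrMr ?expR_gt0// mul1r.
by apply: le_trans (expR_ge1Dx _); rewrite lerDr.
Qed.

End RemainderBound.

(** * Reduction of the profile to the children of the root *)

Section LinearPart.
Context {R : realType} {n : nat}.
Local Notation E := (@rrt_expect R n).
Local Notation H := (hsum n : R).
Local Notation h := (@hrest R n).
Implicit Types (t : rtree_code n) (k K : nat).

Lemma hrestE0 : h 0 = H. Proof. by rewrite /hrest hsum0 subr0. Qed.

Lemma hrestnn : h n = 0. Proof. by rewrite /hrest subrr. Qed.

(** Each summand is a second-order Taylor remainder of [cdpow k d] for the step from h_(i+1) to h_i,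
    of length 1/(i+1). *)
Definition drift k i (D : nat -> nat) : R := \sum_(0 <= j < i.+1)
  (cdpow k (D j) (h i) - cdpow k (D j) (h i.+1) - i.+1%:R^-1 * cdpow k (D j).+1
    (h i.+1)).

Lemma level_countE t k :
  (level_count t k)%:R = \sum_(0 <= j < n.+1) (rdepth t j == k)%:R :> R.
Proof.
rewrite big_mkord /level_count -natr_sum -sum1dep_card big_mkcond /=.
by congr (_%:R); apply: eq_bigr => j _; case: eqP.
Qed.

(** The potential [A i] sums the weights of the vertices present at time i. It starts at the weight
    of the root, ends at the level count because h_n = 0 turns weights into indicators, and each
    increment is [noise] minus [drift]. *)
Lemma level_count_decomp t k :
  (level_count t k)%:R = dpow k H
    + \sum_(0 <= i < n) noise (fun d => cdpow k d (h i.+1)) i (rdepth t)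
    - \sum_(0 <= i < n) drift k i (rdepth t).
Proof.
pose A i : R := \sum_(0 <= j < i.+1) cdpow k (rdepth t j) (h i).
have -> : (level_count t k)%:R = A n.
  by rewrite level_countE; apply: eq_bigr => j _; rewrite hrestnn cdpow_at0.
have -> : dpow k H = A 0%N.
  by rewrite /A big_nat1 rdepth0 hrestE0 /cdpow leq0n subn0.
rewrite -addrA -sumrB; apply/eqP; rewrite addrC -subr_eq; apply/eqP.
rewrite -(telescope_sumr A (leq0n n)); apply: eq_bigr => i _.
rewrite /A [X in X - _]big_nat_recr//= /noise /drift mulr_sumr !sumrB; ring.
Qed.

Lemma drift_ge0 k i t : (i < n)%N -> 0 <= drift k i (rdepth t).
Proof.
move=> ni; apply: sumr_ge0 => j _; rewrite -addrA -opprD subr_ge0 [h i]hrestS.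
by apply: cdpowD_ge_linear; rewrite ?hrest_ge0 ?invr_ge0.
Qed.

(** The quadratic remainder carries the weight for depth d+2; averaged with the occupancy bound, the
    sum over d is the binomial expansion of (h_i + H_i)^(K-1)/(K-1)!. *)
Lemma expect_drift_le K i : (i < n)%N -> (0 < K)%N ->
  E (fun t => drift K.+1 i (rdepth t)) <= i.+1%:R^-1 ^+ 2 * dpow K.-1 H.
Proof.
move=> ni; case: K => // K _ /=.
apply: le_trans (_ : _ <= E (fun t => i.+1%:R^-1 ^+ 2 *
  \sum_(0 <= j < i.+1) cdpow K.+2 (rdepth t j).+2 (h i))) _.
  apply: rrt_expect_le => t _; rewrite mulr_sumr; apply: ler_sum => j _.
  rewrite -addrA -opprD lerBlDl [h i]hrestS.
  by apply: cdpowD_le_quadratic; rewrite ?hrest_ge0 ?invr_ge0.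
rewrite rrt_expectZ ler_wpM2l ?sqr_ge0//.
apply: le_trans (expect_sum_depth_le (g := fun d => cdpow K.+2 d.+2 (h i)) (B :=
  K.+1) (ltnW ni) _ _) _.
- by move=> d; rewrite cdpow_ge0// hrest_ge0// ltnW.
- by move=> d Kd; rewrite /cdpow !ltnS leqNgt Kd.
rewrite -[H](subrK (hsum i)) -dpowD le_eqVlt; apply/orP; left; apply/eqP.
apply: eq_bigr => -[d /= dK] _; rewrite mulrC; congr (_ * _).
by rewrite /cdpow !ltnS -ltnS dK !subSS.
Qed.

Definition deep k i d : R := if (d <= 1)%N then 0 else cdpow k d (h i.+1).

(** The conditional probability of depth 1 is 1/(i+1), the root being the only possible parent of
    depth 0. *)
Lemma noise_split K i t : noise (fun d => cdpow K.+1 d (h i.+1)) i (rdepth t)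
  = dpow K (h i.+1) * ((rdepth t i.+1 == 1%N)%:R - i.+1%:R^-1)
    + noise (deep K.+1 i) i (rdepth t).
Proof.
have dE d : cdpow K.+1 d.+1 (h i.+1)
    = dpow K (h i.+1) * (d == 0%N)%:R + deep K.+1 i d.+1.
  by case: d => [|d]; rewrite /deep /= ?mulr1 ?addr0 ?mulr0 ?add0r// /cdpow /= subn1.
have -> : i.+1%:R^-1 = i.+1%:R^-1 * \sum_(0 <= j < i.+1) (rdepth t j == 0%N)%:R :> R.
  by rewrite big_nat_recl//= big1 ?addr0 ?mulr1// => j _; rewrite rdepth_eq0.
rewrite /noise; under eq_bigr do rewrite dE; rewrite big_split /= -mulr_sumr.
have -> : rdepth t i.+1 = (rdepth t i.+1).-1.+1 by [].
by rewrite dE eqSS; ring.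
Qed.

(** Orthogonality reduces to single variances, estimated with s = H_(i+1)/H. Their sum is at most 8
    (K/H) times 8 H/K, which is 64. *)
Lemma deep_noise_bound K : (2 <= K)%N -> 0 < H -> K%:R / H <= 2^-1 ->
  (K`!%:R / H ^+ K) ^+ 2 *
  E (fun t => (\sum_(0 <= i < n) noise (deep K.+1 i) i (rdepth t)) ^+ 2) <= 64.
Proof.
move=> K2 H0 eH.
have c0 : 0 <= (K`!%:R / H ^+ K) ^+ 2 by exact: sqr_ge0.
apply: le_trans (ler_wpM2l c0 (noise_sum_second_moment _ (leqnn n))) _.
have K0 : 0 < K%:R :> R by rewrite ltr0n (leq_trans _ K2).
have step i : (i < n)%N -> (K`!%:R / H ^+ K) ^+ 2 * E (fun t => deep K.+1 i
  (rdepth t i.+1) ^+ 2)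
    <= i.+1%:R^-1 * (8 * (K%:R / H) * expR (- (K%:R / 8 / H * hsum i.+1))).
  move=> ni.
  have s0 : 0 <= hsum i.+1 / H by rewrite divr_ge0 ?hsum_ge0.
  have s1 : hsum i.+1 / H <= 1 by rewrite ler_pdivrMr// mul1r hsum_le.
  have deep0 d : (K.+1 <= d)%N -> deep K.+1 i d.+1 = 0.
    by move=> Kd; rewrite /deep /cdpow !ltnS [(d <= K)%N]leqNgt Kd; case: ifP.
  apply: le_trans (ler_wpM2l c0 (expect_sq_depth ni deep0)) _.
  rewrite mulrCA ler_wpM2l ?invr_ge0//.
  have := le_trans (remainder_term K H0 s0 s1) (remainder_term_exp K2 H0 eH s0 s1).
  rewrite divfK ?gt_eqF// mulrBl mul1r divfK ?gt_eqF//.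
  rewrite (_ : K%:R / 8 * (hsum i.+1 / H) = K%:R / 8 / H * hsum i.+1); last by ring.
  apply: le_trans; rewrite ler_wpM2l//.
  rewrite -(big_mkord predT (fun d => deep K.+1 i d.+1 ^+ 2 * dpow d (hsum i))).
  (* The term d = 0 concerns depth 1, where [deep] vanishes. *)
  rewrite big_ltn// /deep leqnn expr0n mul0r add0r.
  rewrite !big_nat; apply: ler_sum => d /andP[d1 dK].
  rewrite ltnS leqNgt d1 /= /cdpow ltnS -ltnS dK subSS.
  (* The occupancy bound in H_i is enlarged to H_(i+1), so that s H and (1 - s) H add up to H. *)
  rewrite ler_wpM2l ?sqr_ge0//.
  by rewrite ler_wpM2r ?invr_ge0// lerXn2r ?nnegrE ?hsum_ge0// hsum_le.
rewrite mulr_sumr; apply: le_trans (_ : \sum_(0 <= i < n) 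
   (8 * (K%:R / H)) * (i.+1%:R^-1 * expR (- (K%:R / 8 / H * hsum i.+1))) <= _).
  rewrite !big_nat; apply: ler_sum => i /andP[_ ni].
  by apply: le_trans (step _ ni) _; rewrite mulrCA mulrA.
rewrite -mulr_sumr.
have c1 : 0 < K%:R / 8 / H by rewrite !divr_gt0.
apply: le_trans (ler_wpM2l _ (sum_exp_hsum_le n c1)) _.
  by rewrite mulr_ge0 ?divr_ge0 ?ltW.
rewrite [leLHS](_ : _ = 64) //.
by field; rewrite !gt_eqF.
Qed.

(** The constant is 4 + 64/16 from the deep noise, by |a| <= 4 + a^2/16, plus 1 from the drift,
    whose normalized mean is at most 2K/H. *)
Lemma level_count_linear K : (2 <= K)%N -> 0 < H -> K%:R / H <= 2^-1 ->
  E (fun t => `|K`!%:R / H ^+ K * ((level_count t K.+1)%:R - dpow K.+1 H)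
     - \sum_(0 <= i < n) (h i.+1 / H) ^+ K
         * ((rdepth t i.+1 == 1%N)%:R - i.+1%:R^-1)|) <= 9.
Proof.
move=> K2 H0 eH; set c := _ / _.
have c0 : 0 <= c by rewrite divr_ge0 ?exprn_ge0 ?ltW.
pose S t : R := \sum_(0 <= i < n) noise (deep K.+1 i) i (rdepth t).
pose B t : R := \sum_(0 <= i < n) drift K.+1 i (rdepth t).
have B0 t : 0 <= B t by rewrite /B big_nat sumr_ge0// => i /andP[_ ni]; exact:
  drift_ge0.
apply: le_trans (_ : _ <= E (fun t => (4 + 16^-1 * (c ^+ 2 * S t ^+ 2)) + c * B t)) _.
  apply: rrt_expect_le => t _.
  rewrite [X in `|X|](_ : _ = c * S t - c * B t); last first.
    rewrite level_count_decomp -/(B t); under eq_bigr do rewrite noise_split.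
    rewrite big_split /= -/(S t).
    rewrite [X in _ - X](_ : _ = c * \sum_(0 <= i < n) dpow K (h i.+1)
         * ((rdepth t i.+1 == 1%N)%:R - i.+1%:R^-1)); first by ring.
    rewrite mulr_sumr; apply: eq_bigr => i _; rewrite mulrA; congr (_ * _).
    have f0 : (K`!%:R : R) != 0 by rewrite pnatr_eq0 -lt0n fact_gt0.
    have HK : H ^+ K != 0 by rewrite expf_neq0 ?gt_eqF.
    rewrite /c /dpow expr_div_n; move: (H ^+ K) (K`!%:R : R) HK f0 => a b a0 b0.
    by field; rewrite a0 b0.
  apply: le_trans (ler_normB _ _) _.
  rewrite [`|c * B t|]ger0_norm; last exact: mulr_ge0.
  rewrite lerD2r.
  rewrite -exprMn -real_normK ?num_real//; move: `|_| => a.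
  by have := sqr_ge0 (a - 8); nra.
rewrite !rrt_expectD !rrt_expectZ rrt_expect_cst.
have := deep_noise_bound K2 H0 eH; rewrite -/c => hS.
suff : c * E B <= 1 by move: hS; rewrite /S; lra.
rewrite rrt_expect_sum.
have K0 : (0 < K)%N by exact: leq_trans K2.
apply: le_trans (_ : c * (2 * dpow K.-1 H) <= _).
  rewrite ler_wpM2l//.
  apply: le_trans (_ : \sum_(0 <= i < n) i.+1%:R^-1 ^+ 2 * dpow K.-1 H <= _).
    by rewrite !big_nat; apply: ler_sum => i /andP[_ ni]; apply: expect_drift_le.
  by rewrite -mulr_suml ler_wpM2r ?dpow_ge0 ?sum_inv_sq_le// ltW.
rewrite [leLHS](_ : _ = 2 * (K%:R / H)); first lra.
rewrite /c /dpow -{1 2 5}(prednK K0) factS natrM exprS (prednK K0).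
have f0 : (K.-1`!%:R : R) != 0 by rewrite pnatr_eq0 -lt0n fact_gt0.
have HK : H ^+ K.-1 != 0 by rewrite expf_neq0 ?gt_eqF.
have HN : H != 0 by rewrite gt_eqF.
move: (H) (H ^+ K.-1) (K.-1`!%:R : R) HK f0 HN => z a b a0 b0 z0.
by field; rewrite z0 a0 b0.
Qed.

End LinearPart.

(** * Characteristic function of the linear part *)

Section TrigBounds.
Context {R : realType}.
Implicit Types (x y a b : R).

Lemma derive_bound (f df : R -> R) (M a b : R) :
  (forall x, is_derive x 1 f (df x)) ->
  (forall x, Num.min a b <= x <= Num.max a b -> `|df x| <= M) ->
  `|f b - f a| <= M * `|b - a|.
Proof.
move=> fd dM.
have cf : continuous f.
  by move=> x; apply/differentiable_continuous/derivable1_diffP; case: (fd x).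
wlog ab : a b dM / a <= b.
  move=> W; have [/W|/ltW/W] := leP a b; first exact.
  by rewrite distrC [X in _ <= _ * X]distrC; apply; rewrite minC maxC.
have [c] := @MVT_segment _ f df a b ab (fun x _ => fd x) (continuous_subspaceT cf).
rewrite in_itv /= => cab ->; rewrite normrM ler_wpM2r// dM//.
by rewrite min_l// max_r.
Qed.

Lemma cos_lipschitz a b : `|cos b - cos a| <= `|b - a|.
Proof.
rewrite -[leRHS]mul1r; apply: (@derive_bound _ (fun x => - sin x)) => x _.
by rewrite normrN sin_max.
Qed.

Lemma sin_lipschitz a b : `|sin b - sin a| <= `|b - a|.
Proof.
rewrite -[leRHS]mul1r; apply: (@derive_bound _ cos) => x _.
exact: cos_max.
Qed.

Lemma le_norm_between x y : Num.min 0 x <= y <= Num.max 0 x -> `|y| <= `|x|.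
Proof.
have [x0|x0] := leP 0 x.
  by move=> /andP[y0 yx]; rewrite !ger0_norm.
by move=> /andP[yx y0]; rewrite !ler0_norm ?lerN2// ltW.
Qed.

Lemma norm_sin_le x : `|sin x| <= `|x|.
Proof. by have := sin_lipschitz 0 x; rewrite sin0 !subr0. Qed.

(** This bound and the next two follow each from the preceding one by the mean value inequality,
    whence constants larger than Taylor's. *)
Lemma cos_sub1_le x : `|cos x - 1| <= x ^+ 2.
Proof.
have := @derive_bound cos (fun x => - sin x) `|x| 0 x _ _.
rewrite cos0 subr0 -expr2 real_normK ?num_real//; apply.
by move=> y /le_norm_between xy; rewrite normrN (le_trans (norm_sin_le _)).
Qed.

Lemma sin_subid_le x : `|sin x - x| <= `|x| ^+ 3.
Proof.
have := @derive_bound (fun x => sin x - x) (fun x => cos x - 1) (`|x| ^+ 2) 0 x _ _.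
rewrite sin0 !subr0 -exprSr; apply.
move=> y /le_norm_between xy; apply: le_trans (cos_sub1_le _) _.
by rewrite -real_normK ?num_real// lerXn2r ?nnegrE.
Qed.

Lemma cos_quadratic_le x : `|cos x - (1 - x ^+ 2 / 2)| <= `|x| ^+ 4.
Proof.
have := @derive_bound (fun x => cos x - (1 - x ^+ 2 / 2)) (fun x => - (sin x -
  x)) (`|x| ^+ 3) 0 x _ _.
rewrite cos0 expr0n mul0r !subr0 subrr subr0 -exprSr; apply.
  move=> y; apply: is_derive_eq.
  rewrite !scaler0 /GRing.scale /=; lra.
move=> y /le_norm_between xy; rewrite normrN; apply: le_trans (sin_subid_le _) _.
by rewrite lerXn2r ?nnegrE.
Qed.

Lemma expRN_quadratic_le x : 0 <= x -> `|expR (- x) - (1 - x)| <= x ^+ 2.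
Proof.
move=> x0; have := expR_ge1Dx (- x); rewrite ler_norml => h.
apply/andP; split; first by have := sqr_ge0 x; lra.
have h2 := expR_ge1Dx x.
have : expR (- x) * expR x = 1 by rewrite -expRD addNr expR0.
have := expR_gt0 (- x); move: (expR (- x)) (expR x) h h2 => u v; nra.
Qed.

End TrigBounds.

(** * Lindeberg replacement for the children of the root *)

Section CentralLimit.
Context {R : realType} {n : nat}.
Local Notation E := (@rrt_expect R n).
Implicit Types (C : nat -> R) (D : nat -> nat).

Definition root_sum C N D : R :=
  \sum_(0 <= i < N) C i * ((D i.+1 == 1%N)%:R - i.+1%:R^-1).

(** The variance of [root_sum]: vertex i+1 is a child of the root with probability 1/(i+1),
    independently over i. *)
Definition root_var C N : R :=
  \sum_(0 <= i < N) C i ^+ 2 * (i.+1%:R^-1 * (1 - i.+1%:R^-1)).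

(** The mean of g(c(X - p)) for a Bernoulli variable X of parameter p = 1/(i+1). *)
Definition bmean (g : R -> R) (c : R) (i : nat) : R :=
  i.+1%:R^-1 * g (c * (1 - i.+1%:R^-1)) + (1 - i.+1%:R^-1) * g (- (c * i.+1%:R^-1)).

Lemma root_sum_local C N D D' : (forall v, (v <= N)%N -> D v = D' v) ->
  root_sum C N D = root_sum C N D'.
Proof. by move=> DD; apply: eq_big_nat => i /andP[_ iN]; rewrite DD. Qed.

Lemma root_sumS C N D : root_sum C N.+1 D
  = root_sum C N D + C N * ((D N.+1 == 1%N)%:R - N.+1%:R^-1).
Proof. by rewrite /root_sum big_nat_recr. Qed.

(** Independence of the past: whatever the tree so far, exactly one of the i+1 candidate parents is
    the root. *)
Lemma expect_root_step (f g : R -> R) C i : (i < n)%N ->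
  E (fun t => f (root_sum C i (rdepth t))
      * g (C i * ((rdepth t i.+1 == 1%N)%:R - i.+1%:R^-1)))
  = E (fun t => f (root_sum C i (rdepth t))) * bmean g (C i) i.
Proof.
move=> ni.
have loc D D' : (forall v, (v <= i)%N -> D v = D' v) ->
    f (root_sum C i D) = f (root_sum C i D').
  by move=> DD; rewrite (root_sum_local _ DD).
rewrite (rrt_expect_next (fun d => g (C i * ((d == 1%N)%:R - i.+1%:R^-1))) ni loc).
rewrite mulrC -rrt_expectZ; apply: eq_rrt_expect => t _.
rewrite mulrC; congr (_ * _).
rewrite big_nat_recl//= (eq_big_nat _ _ (F2 := fun=> g (- (C i * i.+1%:R^-1))));
  last first.
  by move=> j _; rewrite /= sub0r mulrN.
rewrite sumr_const_nat subn0 -[_ *+ i]mulr_natl /bmean mulrDr; congr (_ + _).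
rewrite mulrA; congr (_ * _).
have : (i.+1%:R : R) != 0 by rewrite pnatr_eq0.
rewrite -[i.+1%:R]natr1; move: (i%:R : R) => a a0.
by field.
Qed.

(** Both values of the centered variable are at most d in absolute value, where |x|^(r+2) <= d^r
    x^2; the mean of x^2 is the variance. *)
Lemma bmean_approx (g h : R -> R) (c d : R) (i r : nat) : `|c| <= d ->
  (forall x, `|g x - h x| <= `|x| ^+ r.+2) ->
  `|bmean g c i - bmean h c i|
    <= d ^+ r * (c ^+ 2 * (i.+1%:R^-1 * (1 - i.+1%:R^-1))).
Proof.
move=> cd gh; rewrite /bmean.
have p0 : 0 <= i.+1%:R^-1 :> R by rewrite invr_ge0.
have q0 : 0 <= 1 - i.+1%:R^-1 :> R by rewrite subr_ge0 invf_le1// ler1n.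
move: p0 q0; set p := _^-1; set q := 1 - p => p0 q0.
have pq : p + q = 1 by rewrite /q; lra.
have step x : `|x| <= d -> `|g x - h x| <= d ^+ r * x ^+ 2.
  move=> xd; apply: le_trans (gh x) _; rewrite -addn2 exprD real_normK ?num_real//.
  by rewrite ler_wpM2r ?sqr_ge0// lerXn2r ?nnegrE// (le_trans _ xd).
rewrite (_ : _ - _ = p * (g (c * q) - h (c * q)) + q * (g (- (c * p)) - h (- (c *
  p)))); last by ring.
apply: le_trans (ler_normD _ _) _; rewrite !normrM (ger0_norm p0) (ger0_norm q0).
have cq : `|c * q| <= d.
  by rewrite normrM (ger0_norm q0) (le_trans _ cd)// ler_piMr//; lra.
have cp : `|- (c * p)| <= d.
  by rewrite normrN normrM (ger0_norm p0) (le_trans _ cd)// ler_piMr//; lra.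
apply: le_trans (lerD (ler_wpM2l p0 (step _ cq)) (ler_wpM2l q0 (step _ cp))) _.
rewrite le_eqVlt; apply/orP; left; apply/eqP.
by rewrite [in RHS](_ : p * q = p * q * (p + q)); [ring|rewrite pq mulr1].
Qed.

(** Both sides are compared with 1 - v/2, with errors at most d^2 v and v^2/4; v <= d^2 and d <= 1
    conclude. *)
Lemma bmean_cos_le (c d : R) i : `|c| <= d -> d <= 1 ->
  let v := c ^+ 2 * (i.+1%:R^-1 * (1 - i.+1%:R^-1)) in
  `|bmean cos c i - expR (- (v / 2))| <= 2 * d * v.
Proof.
move=> cd d1 /=; set v := c ^+ 2 * _.
have := bmean_approx (r := 2) i cd cos_quadratic_le; rewrite -/v.
have p0 : 0 <= i.+1%:R^-1 :> R by rewrite invr_ge0.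
have p1 : i.+1%:R^-1 <= 1 :> R by rewrite invf_le1// ler1n.
have -> : bmean (fun x => 1 - x ^+ 2 / 2) c i = 1 - v / 2.
  by rewrite /bmean /v; set p := _^-1; field.
have d0 : 0 <= d by exact: le_trans cd.
have v0 : 0 <= v.
  by apply: mulr_ge0; [exact: sqr_ge0|apply: mulr_ge0 => //; rewrite subr_ge0].
have vd : v <= d ^+ 2.
  rewrite /v; apply: le_trans (_ : c ^+ 2 * 1 <= _).
    by rewrite ler_wpM2l ?sqr_ge0//; move: p0 p1; set p := _^-1; nra.
  by rewrite mulr1 -real_normK ?num_real// lerXn2r ?nnegrE.
have := expRN_quadratic_le (divr_ge0 v0 (ler0n R 2)).
move=> h1 h2; rewrite (_ : _ - _ = (bmean cos c i - (1 - v / 2)) - (expR (- (v /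
  2)) - (1 - v / 2))); last by ring.
apply: le_trans (ler_normB _ _) _; apply: le_trans (lerD h2 h1) _.
clearbody v.
have k1 : 0 <= v * (d * (1 - d)) by rewrite !mulr_ge0// subr_ge0.
have k2 : 0 <= v * (d ^+ 2 - v) by rewrite mulr_ge0// subr_ge0.
have k3 : 0 <= v * d by rewrite mulr_ge0.
nra.
Qed.

Lemma bmean_sin_le (c d : R) i : `|c| <= d ->
  let v := c ^+ 2 * (i.+1%:R^-1 * (1 - i.+1%:R^-1)) in
  `|bmean sin c i| <= d * v.
Proof.
move=> cd /=; set v := c ^+ 2 * _; have := bmean_approx (r := 1) i cd sin_subid_le.
rewrite -/v expr1; have -> : bmean id c i = 0 by rewrite /bmean; ring.
by rewrite subr0.
Qed.

(** One variable is added at a time by the addition formulas, which forces a joint induction on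
    cosine and sine. The old errors are multiplied by factors at most 1, so the errors add up; for
    the cosine a step costs 2d from [bmean_cos_le] and d from [bmean_sin_le], per unit of
    variance. *)
Lemma root_sum_char C (d : R) N : (N <= n)%N -> d <= 1 ->
  (forall i, (i < N)%N -> `|C i| <= d) ->
  `|E (fun t => cos (root_sum C N (rdepth t))) - expR (- (root_var C N / 2))|
     <= 3 * d * root_var C N /\
  `|E (fun t => sin (root_sum C N (rdepth t)))| <= d * root_var C N.
Proof.
move=> Nn d1; elim: N Nn => [|N IH] Nn Cd.
  under eq_rrt_expect do rewrite /root_sum big_geq// cos0.
  under [X in _ /\ `|X| <= _]eq_rrt_expect do rewrite /root_sum big_geq// sin0.
  rewrite !rrt_expect_cst /root_var big_geq// mul0r oppr0 expR0 subrr normr0.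
  by rewrite !mulr0.
have [] := IH (ltnW Nn) (fun i iN => Cd i (ltnW iN)).
under [X in _ -> _ -> `|X - _| <= _ /\ _]eq_rrt_expect do rewrite root_sumS cosD.
under [X in _ -> _ -> _ /\ `|X| <= _]eq_rrt_expect do rewrite root_sumS sinD.
rewrite rrt_expectB rrt_expectD !expect_root_step//.
have EC : `|E (fun t => cos (root_sum C N (rdepth t)))| <= 1.
  apply: le_trans (rrt_expect_norm _) _; rewrite -[leRHS](rrt_expect_cst (n := n)).
  by apply: rrt_expect_le => t _; exact: cos_max.
have ES : `|E (fun t => sin (root_sum C N (rdepth t)))| <= 1.
  apply: le_trans (rrt_expect_norm _) _; rewrite -[leRHS](rrt_expect_cst (n := n)).
  by apply: rrt_expect_le => t _; exact: sin_max.
have := bmean_cos_le N (Cd N (ltnSn N)) d1.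
have := bmean_sin_le N (Cd N (ltnSn N)).
move: EC ES; move: (E (fun t => cos _)) (E (fun t => sin _)) => x y x1 y1 /=.
rewrite /root_var big_nat_recr//= -/(root_var C N).
have bc1 : `|bmean cos (C N) N| <= 1.
  have p0 : 0 <= N.+1%:R^-1 :> R by rewrite invr_ge0.
  have p1 : 0 <= 1 - N.+1%:R^-1 :> R by rewrite subr_ge0 invf_le1// ler1n.
  apply: le_trans (ler_normD _ _) _; rewrite !normrM ger0_norm// [X in _ + X *
    _]ger0_norm//.
  have u1 := cos_max (C N * (1 - N.+1%:R^-1)).
  have v1 := cos_max (- (C N * N.+1%:R^-1)).
  apply: le_trans (lerD (ler_wpM2l p0 u1) (ler_wpM2l p1 v1)) _.
  by rewrite !mulr1 subrKC.
set w := C N ^+ 2 * _; set v := root_var C N.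
set bc := bmean cos _ _ in bc1 *; set bs := bmean sin _ _ => hs hc hx hy.
have w0 : 0 <= w.
  apply: mulr_ge0; [exact: sqr_ge0|apply: mulr_ge0; first by rewrite invr_ge0].
  by rewrite subr_ge0 invf_le1// ler1n.
clearbody w v bc bs.
have ew : expR (- (w / 2)) <= 1 by rewrite -[leRHS]expR0 ler_expR; lra.
have ew0 := expR_ge0 (- (w / 2)).
rewrite (_ : - ((v + w) / 2) = - (v / 2) + - (w / 2)); last by lra.
rewrite expRD; move: (expR (- (w / 2))) ew ew0 hc => e e1 e0 hc.
move: (expR (- (v / 2))) hx => f hx.
split.
  rewrite (_ : x * bc - y * bs - f * e = x * (bc - e) + (x - f) * e - y * bs);
    last by ring.
  apply: le_trans (ler_normB _ _) _; apply: le_trans (lerD (ler_normD _ _) (lexx _)) _.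
  rewrite !normrM (ger0_norm e0).
  move: hs hc hx x1 y1 (normr_ge0 bs) (normr_ge0 (bc - e)) (normr_ge0 (x - f)).
  move: `|bs| `|bc - e| `|x - f| `|x| `|y| => r1 r2 r3 r4 r5 *.
  have : r4 * r2 <= r2 by nra.
  have : r3 * e <= r3 by nra.
  have : r5 * r1 <= r1 by nra.
  lra.
apply: le_trans (ler_normD _ _) _; rewrite !normrM.
move: hs hy bc1 x1 (normr_ge0 bs) (normr_ge0 y).
move: `|bs| `|y| `|bc| `|x| => r1 r2 r3 r4 *.
have : r4 * r1 <= r1 by nra.
have : r2 * r3 <= r2 by nra.
lra.
Qed.

End CentralLimit.

(** * Trigonometric approximation *)

Section Bernstein.
Context {R : realType} {m : nat}.
Implicit Types (p : 'I_m -> R) (s : seq 'I_m) (F G : ('I_m -> nat) -> R).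

(* The expectation of F at the numbers of successes per coordinate, after
   independent trials, one of success probability [p i] for each [i] in [s]. *)
Fixpoint bern p s F : R :=
  if s is i :: s' then
    (1 - p i) * bern p s' F + p i * bern p s' (fun k => F (fun j => ((j == i) + k j)%N))
  else F (fun=> 0%N).

Lemma bernD p s F G : bern p s (fun k => F k + G k) = bern p s F + bern p s G.
Proof. by elim: s F G => [//|i s IH] F G /=; rewrite !IH; ring. Qed.

Lemma bernZ p s a F : bern p s (fun k => a * F k) = a * bern p s F.
Proof. by elim: s F => [//|i s IH] F /=; rewrite !IH; ring. Qed.

Lemma bern_cst p s a : bern p s (fun=> a) = a.
Proof. by elim: s => [//|i s IH] /=; rewrite !IH; ring. Qed.

Lemma bern_sum p s (I : Type) (r : seq I) (F : I -> ('I_m -> nat) -> R) :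
  bern p s (fun k => \sum_(i <- r) F i k) = \sum_(i <- r) bern p s (F i).
Proof.
elim: r => [|x r IH].
  by rewrite big_nil -[RHS](bern_cst p s); congr bern; apply/funext => k; rewrite
    big_nil.
rewrite big_cons -IH -bernD; congr bern; apply/funext => k; by rewrite big_cons.
Qed.

Lemma bern_le p s F G : (forall i, 0 <= p i <= 1) -> (forall k, F k <= G k) ->
  bern p s F <= bern p s G.
Proof.
move=> p01; elim: s F G => [|i s IH] F G FG /=; first exact: FG.
have /andP[p0 p1] := p01 i.
by apply: lerD; apply: ler_wpM2l; rewrite ?subr_ge0//; apply: IH.
Qed.

(** Variance plus squared bias of a binomial count; a success at i is absorbed in the induction by
    shifting c to c - 1. *)
Lemma bern_sq p s i (c : R) :
  bern p s (fun k => ((k i)%:R - c) ^+ 2)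
  = (count_mem i s)%:R * (p i * (1 - p i)) + ((count_mem i s)%:R * p i - c) ^+ 2.
Proof.
elim: s c => [|j s IH] c /=; first by ring.
rewrite IH; case: (eqVneq j i) => [->|ji].
  rewrite (_ : (fun k => _) = (fun k : 'I_m -> nat => ((k i)%:R - (c - 1)) ^+
    2)); last first.
    by apply/funext => k; rewrite natrD /=; congr (_ ^+ 2); ring.
  by rewrite IH natrD /=; ring.
rewrite (_ : (fun k => _) = (fun k : 'I_m -> nat => ((k i)%:R - c) ^+ 2)); last first.
  by apply/funext => k; rewrite add0n.
by rewrite IH add0n; ring.
Qed.

Definition repeated (M : nat) : seq 'I_m := flatten [seq nseq M i | i <- enum 'I_m].

Lemma count_repeated M i : count_mem i (repeated M) = M.
Proof.
rewrite /repeated count_flatten -map_comp sumnE big_map big_enum /=.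
rewrite (bigD1 i)//= count_nseq /= eqxx mul1n big1 ?addn0// => j ji.
by rewrite count_nseq /= (negbTE ji).
Qed.

(** Only [x] is confined to the box, [y] may leave it. Compactness enters in its covering form: near
    each point, one radius serves all neighbours and all smaller d. *)
Lemma box_unif_cont (f : 'rV[R]_m -> R) (A e : R) : continuous f -> 0 < e ->
  exists2 d : R, 0 < d & forall x y : 'rV[R]_m,
    (forall i, `|x ord0 i| <= A) -> (forall i, `|x ord0 i - y ord0 i| < d) ->
    `|f x - f y| <= e.
Proof.
move=> cf e0.
have cK : compact [set v : 'rV[R]_m | forall i, `[-A, A]%classic (v ord0 i)].
  exact: (@rV_compact R m (fun=> `[-A, A]%classic) (fun=> @segment_compact R _ _)).
have := (compact_near_coveringP _).1 cK.
pose Q (d : R) (x : 'rV[R]_m) := forall y : 'rV[R]_m,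
  (forall i, `|x ord0 i - y ord0 i| < d) -> `|f x - f y| <= e.
move=> /(_ _ (0 : R)^'+ Q _); case.
  move=> x _.
  have e2 : 0 < e / 2 by rewrite divr_gt0.
  have := cf x => /cvgrPdist_lt /(_ _ e2) /nbhs_ballP[r /= r0 rB].
  have r2 : 0 < r / 2 by rewrite divr_gt0.
  exists (ball x (r / 2), [set d : R | d < r / 2]) => /=.
    split; first by apply: nbhsx_ballx.
    by apply: nbhs_right_lt.
  move=> [z d] /= [[_ xz] dr] y zy.
  have fz : `|f x - f z| < e / 2.
    apply: rB; split => // i j.
    have xzij : `|x i j - z i j| < r / 2 := xz i j.
    by rewrite /ball /=; lra.
  have fy : `|f x - f y| < e / 2.
    apply: rB; split => // i j; rewrite ord1 /ball /=.
    rewrite (_ : x ord0 j - y ord0 j = (x ord0 j - z ord0 j) + (z ord0 j - y ord0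
      j)); last by ring.
    rewrite (splitr r); apply: le_lt_trans (ler_normD _ _) _; apply: ltrD.
      exact: xz.
    exact: lt_trans (zy j) dr.
  rewrite (_ : f z - f y = (f x - f y) - (f x - f z)); last by ring.
  by apply: le_trans (ler_normB _ _) _; lra.
move=> d /= d0 H; exists (d / 2); first by rewrite divr_gt0.
move=> x y xA xy; apply: (H (d / 2)) => //=; rewrite ?divr_gt0//.
- by rewrite /ball_ /= sub0r normrN gtr0_norm ?divr_gt0// ltr_pdivrMr//; lra.
- by move=> i; rewrite in_itv /= -ler_norml.
Qed.

(** Bernstein's argument with Chebyshev's inequality. When all frequencies are within d of the
    probabilities, uniform continuity gives e/2; otherwise 2B is at most 2B/d^2 times a squared
    deviation, whose mean is of order 1/M. *)
Lemma bernstein_approx (G : 'rV[R]_m -> R) (B e : R) : continuous G ->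
  (forall x, `|G x| <= B) -> 0 < e ->
  exists M : nat, forall p, (forall i, 0 <= p i <= 1) ->
   `|bern p (repeated M) (fun k => G (\row_i ((k i)%:R / M%:R))) - G (\row_i p i)| <= e.
Proof.
move=> cG GB e0; have e2 : 0 < e / 2 by rewrite divr_gt0.
have [d d0 dP] := box_unif_cont 1 cG e2.
have B0 : 0 <= B by exact: le_trans (GB 0).
pose c := 2 * B / d ^+ 2; have c0 : 0 <= c.
  by apply: divr_ge0; [apply: mulr_ge0|exact: sqr_ge0].
(* The number of trials per coordinate is chosen to make the Chebyshev term, at most c m / M, no
   larger than e/2. *)
pose M := (Num.truncn (c * m%:R / (e / 2))).+1.
have M0 : 0 < M%:R :> R by rewrite ltr0n.
have Mlarge : c * m%:R / M%:R <= e / 2.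
  have := truncnS_gt (c * m%:R / (e / 2)); rewrite -/M => /ltW.
  by rewrite ler_pdivrMr// => h; rewrite ler_pdivrMr// [leRHS]mulrC.
have cM : 0 <= c / M%:R ^+ 2 by apply: divr_ge0; [|exact: sqr_ge0].
exists M => p p01; set g := \row_i p i.
rewrite -[G g in X in `|X|](bern_cst p (repeated M)) -mulN1r -bernZ -bernD.
rewrite ler_norml; 
have key k : `|G (\row_i ((k i)%:R / M%:R)) - G g| <=
   e / 2 + c / M%:R ^+ 2 * \sum_(i < m) ((k i)%:R - M%:R * p i) ^+ 2.
  have S0 : 0 <= c / M%:R ^+ 2 * \sum_(i < m) ((k i)%:R - M%:R * p i) ^+ 2.
    by apply: mulr_ge0 => //; apply: sumr_ge0 => i _; rewrite sqr_ge0.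
  have [close|] := pselect (forall i, `|g ord0 i - (\row_i ((k i)%:R / M%:R))
    ord0 i| < d).
    rewrite distrC; apply: le_trans (dP _ _ _ close) _; last by rewrite lerDl.
    by move=> i; rewrite mxE; have /andP[p0 p1] := p01 i; rewrite ger0_norm.
  move=> /existsNP[i /negP]; rewrite -leNgt !mxE => far.
  apply: le_trans (ler_normB _ _) _; apply: le_trans (lerD (GB _) (GB _)) _.
  apply: le_trans (_ : c / M%:R ^+ 2 * ((k i)%:R - M%:R * p i) ^+ 2 <= _); last first.
    rewrite [leLHS](_ : _ = 0 + c / M%:R ^+ 2 * ((k i)%:R - M%:R * p i) ^+ 2);
      last by rewrite add0r.
    apply: lerD; first exact: ltW.
    rewrite ler_wpM2l// (bigD1 i)//= lerDl sumr_ge0// => j _.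
    by rewrite sqr_ge0.
  rewrite [leRHS](_ : _ = 2 * B * (`|p i - (k i)%:R / M%:R| ^+ 2 / d ^+ 2)); last first.
    by rewrite real_normK ?num_real// /c; field; rewrite !gt_eqF.
  rewrite -mulr2n -[B *+ 2]mulr_natl -[leLHS]mulr1 ler_wpM2l ?mulr_ge0//.
  rewrite ler_pdivlMr ?exprn_gt0// mul1r lerXn2r ?nnegrE// ltW//.
have tot : bern p (repeated M) (fun k => e / 2 + c / M%:R ^+ 2 * \sum_(i < m) ((k
  i)%:R - M%:R * p i) ^+ 2) <= e.
  rewrite bernD bern_cst bernZ bern_sum.
  under eq_bigr do rewrite bern_sq count_repeated subrr expr0n addr0.
  rewrite {2}(splitr e) lerD2l; apply: le_trans Mlarge.
  apply: le_trans (_ : c / M%:R ^+ 2 * \sum_(i < m) M%:R <= _).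
    rewrite ler_wpM2l//; apply: ler_sum => i _.
    by have /andP[p0 p1] := p01 i; rewrite ler_piMr//; nra.
  rewrite sumr_const card_ord -mulr_natl le_eqVlt; apply/orP; left; apply/eqP.
  by field; rewrite gt_eqF.
apply/andP; split.
  rewrite lerNl -[leLHS]mulN1r -bernZ; apply: le_trans tot; apply: bern_le => // k.
  by apply: le_trans (key k); rewrite !mulN1r -normrN ler_norm.
by apply: le_trans tot; apply: bern_le => // k; apply: le_trans (key k); rewrite
  mulN1r ler_norm.
Qed.

End Bernstein.

Section TrigPolynomials.
Context {R : realType} {m : nat}.
Implicit Types (s x : 'rV[R]_m) (g h : 'rV[R]_m -> R).

Definition dotr s x : R := \sum_(i < m) s ord0 i * x ord0 i.

Inductive trig_poly : ('rV[R]_m -> R) -> Prop :=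
| TrigCos s : trig_poly (fun x => cos (dotr s x))
| TrigSin s : trig_poly (fun x => sin (dotr s x))
| TrigAdd g h : trig_poly g -> trig_poly h -> trig_poly (fun x => g x + h x)
| TrigScale a g : trig_poly g -> trig_poly (fun x => a * g x).

Lemma dotrD s s' x : dotr (s + s') x = dotr s x + dotr s' x.
Proof. by rewrite -big_split; apply: eq_bigr => i _; rewrite mxE mulrDl. Qed.

Lemma dotrN s x : dotr (- s) x = - dotr s x.
Proof. by rewrite -sumrN; apply: eq_bigr => i _; rewrite mxE mulNr. Qed.

Lemma trig_poly_cst a : trig_poly (fun=> a).
Proof.
rewrite (_ : (fun=> a) = (fun x => a * cos (dotr 0 x))); last first.
  apply/funext => x; rewrite /dotr big1 ?cos0 ?mulr1// => i _.
  by rewrite mxE mul0r.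
exact/TrigScale/TrigCos.
Qed.

(** The product-to-sum formulas treat the generators, bilinearity the rest. *)
Lemma trig_poly_mul g h : trig_poly g -> trig_poly h ->
  trig_poly (fun x => g x * h x).
Proof.
move=> tg; elim: tg h => {g} [s|s|g g' _ IHg _ IHg'|a g _ IHg] h th.
- elim: th => {h} [s'|s'|h h' _ IHh _ IHh'|a h _ IHh].
  + rewrite (_ : (fun _ => _) = (fun x => 2^-1 * (cos (dotr (s + s') x) + cos
      (dotr (s - s') x)))).
      by apply: TrigScale; apply: TrigAdd; exact: TrigCos.
    by apply/funext => x; rewrite !dotrD dotrN cosB cosD; field.
  + rewrite (_ : (fun _ => _) = (fun x => 2^-1 * (sin (dotr (s + s') x) + (-1) *
      sin (dotr (s - s') x)))).
      by apply: TrigScale; apply: TrigAdd; [|apply: TrigScale]; exact: TrigSin.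
    by apply/funext => x; rewrite !dotrD dotrN sinB sinD; field.
  + by under eq_fun do rewrite mulrDr; exact: TrigAdd.
  + by under eq_fun do rewrite mulrCA; exact: TrigScale.
- elim: th => {h} [s'|s'|h h' _ IHh _ IHh'|a h _ IHh].
  + rewrite (_ : (fun _ => _) = (fun x => 2^-1 * (sin (dotr (s + s') x) + sin
      (dotr (s - s') x)))).
      by apply: TrigScale; apply: TrigAdd; exact: TrigSin.
    by apply/funext => x; rewrite !dotrD dotrN sinB sinD; field.
  + rewrite (_ : (fun _ => _) = (fun x => 2^-1 * (cos (dotr (s - s') x) + (-1) *
      cos (dotr (s + s') x)))).
      by apply: TrigScale; apply: TrigAdd; [|apply: TrigScale]; exact: TrigCos.
    by apply/funext => x; rewrite !dotrD dotrN cosB cosD; field.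
  + by under eq_fun do rewrite mulrDr; exact: TrigAdd.
  + by under eq_fun do rewrite mulrCA; exact: TrigScale.
- by under eq_fun do rewrite mulrDl; apply: TrigAdd; [exact: IHg|exact: IHg'].
- by under eq_fun do rewrite -mulrA; apply: TrigScale; exact: IHg.
Qed.

Lemma trig_poly_bern (q : 'I_m -> 'rV[R]_m -> R) (l : seq 'I_m) F :
  (forall i, trig_poly (q i)) -> trig_poly (fun x => bern (fun i => q i x) l F).
Proof.
move=> tq; elim: l F => [|i l IH] F /=; first exact: trig_poly_cst.
apply: TrigAdd; apply: trig_poly_mul => //.
by apply: TrigAdd; [exact: trig_poly_cst|under eq_fun do rewrite -mulN1r; exact:
  TrigScale].
Qed.

Lemma trig_poly_sin_coord (a : R) (i : 'I_m) :
  trig_poly (fun x => sin (x ord0 i / a)).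
Proof.
rewrite (_ : (fun _ => _) = (fun x => sin (dotr (a^-1 *: delta_mx ord0 i) x))).
  exact: TrigSin.
apply/funext => x; congr sin; rewrite /dotr (bigD1 i)//= !mxE !eqxx mulr1 mulrC.
by rewrite big1 ?addr0// => j ji; rewrite !mxE (negbTE ji) mulr0 mul0r.
Qed.

(* f (a sin (x / a)) is a continuous function of the numbers sin (x_i / a)
   in [-1, 1], hence uniformly approximated by polynomials in them; unlike
   an approximation of f on a box, this one holds on the whole space. *)
Lemma trig_poly_approx (f : 'rV[R]_m -> R) (B a e : R) : continuous f ->
  (forall x, `|f x| <= B) -> 0 < e ->
  exists2 g, trig_poly g &
    forall x, `|g x - f (\row_i (a * sin (x ord0 i / a)))| <= e.
Proof.
move=> cf fB e0.
(* An affine change of variables carries the cube [0,1]^m of success probabilities to [-a,a]^m; the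
   probabilities [q] below are (1 + sin(x_i/a))/2. *)
pose G (p : 'rV[R]_m) := f (\row_i (a * (2 * p ord0 i - 1))).
have cG : continuous G.
  move=> p; apply: (@continuous_comp _ _ _ (fun p : 'rV[R]_m => \row_i (a * (2 *
    p ord0 i - 1)))); last exact: cf.
  rewrite (_ : (fun _ => _) = (fun p : 'rV[R]_m => (a * 2) *: p + (- a) *:
    const_mx 1)); last first.
    by apply/funext => q; apply/rowP => i; rewrite !mxE; ring.
  apply: (@continuousD R 'rV[R]_m 'rV[R]_m (fun p : 'rV[R]_m => (a * 2) *: p)
    (fun=> (- a) *: const_mx 1)).
    exact: (@scaler_continuous R 'rV[R]_m).
  exact: cst_continuous.
have GB x : `|G x| <= B by exact: fB.
have [M HM] := bernstein_approx cG GB e0.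
pose q (i : 'I_m) (x : 'rV[R]_m) : R := 2^-1 + 2^-1 * sin (x ord0 i / a).
exists (fun x => bern (fun i => q i x) (repeated M) (fun k => G (\row_i ((k i)%:R
  / M%:R)))).
  apply: trig_poly_bern => i; apply: TrigAdd; first exact: trig_poly_cst.
  by apply: TrigScale; exact: trig_poly_sin_coord.
move=> x; rewrite (_ : f _ = G (\row_i q i x)); last first.
  by rewrite /G; congr f; apply/rowP => i; rewrite !mxE /q; field.
apply: HM => i; rewrite /q; have := sin_le1 (x ord0 i / a); have := sin_geN1 (x
  ord0 i / a).
by move=> ? ?; apply/andP; split; lra.
Qed.

End TrigPolynomials.

Section WeakConvergence.
Context {R : realType} {m : nat} (d : measure_display) (T : measurableType d)
  (P : probability T R) (Z : T -> 'rV[R]_m).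
Local Open Scope ereal_scope.

Lemma bounded_integrable (X : T -> R) (B : R) :
  measurable_fun setT X -> (forall w, `|X w| <= B)%R -> P.-integrable setT (EFin \o X).
Proof.
move=> mX XB; apply: measurable_bounded_integrable => //.
  by apply: le_lt_trans (probability_le1 P measurableT) _; rewrite ltry.
exists B; split; first exact: num_real.
by move=> x Bx w _; exact: le_trans (XB w) (ltW Bx).
Qed.

(** Convergence is given on the generators and passes through linear combinations. Measurability and
    boundedness are carried along because additivity of the integral requires integrability. *)
Lemma trig_poly_expectation (E : nat -> ('rV[R]_m -> R) -> R) :
  (forall n g h, E n (fun x => g x + h x)%R = (E n g + E n h)%R) ->
  (forall n a g, E n (fun x => a * g x)%R = (a * E n g)%R) ->
  (forall s, measurable_fun setT (fun w => dotr s (Z w))) ->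
  (forall s, exists2 c, 'E_P[fun w => cos (dotr s (Z w))] = c%:E &
     E^~ (fun x => cos (dotr s x)) @ \oo --> c) ->
  (forall s, exists2 c, 'E_P[fun w => sin (dotr s (Z w))] = c%:E &
     E^~ (fun x => sin (dotr s x)) @ \oo --> c) ->
  forall g, trig_poly g ->
  [/\ measurable_fun setT (g \o Z), exists B : R, forall x, (`|g x| <= B)%R &
    exists2 c, 'E_P[g \o Z] = c%:E & E^~ g @ \oo --> c].
Proof.
move=> ED EZ mZ Hc Hs g; elim=> {g} [s|s|g h _ [mg [Bg gB] [cg Ig Eg]] _ [mh [Bh
  hB] [ch Ih Eh]]|a g _ [mg [Bg gB] [cg Ig Eg]]].
- split; last exact: Hc; last by exists 1%R => x; exact: cos_max.
  by apply: measurableT_comp (mZ s); apply: continuous_measurable_fun; exact: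
    continuous_cos.
- split; last exact: Hs; last by exists 1%R => x; exact: sin_max.
  by apply: measurableT_comp (mZ s); apply: continuous_measurable_fun; exact:
    continuous_sin.
- split.
  + exact: measurable_funD.
  + exists (Bg + Bh)%R => x; apply: le_trans (ler_normD _ _) _; exact: lerD.
  + exists (cg + ch)%R; last by under eq_fun do rewrite ED; exact: cvgD.
    rewrite EFinD -Ig -Ih unlock -integralD_EFin//.
    * exact: (bounded_integrable mg (fun w => gB (Z w))).
    * exact: (bounded_integrable mh (fun w => hB (Z w))).
- split.
  + exact: measurable_funM.
  + exists (`|a| * Bg)%R => x; rewrite normrM; exact: ler_wpM2l.
  + exists (a * cg)%R; last by under eq_fun do rewrite EZ; exact: cvgMl_tmp.
    rewrite EFinM -Ig unlock -integralZl//.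
    exact: (bounded_integrable mg (fun w => gB (Z w))).
Qed.

End WeakConvergence.

(** * Weak convergence from characteristic functions *)

Section Levy.
Context {R : realType} {m : nat} (d : measure_display) (T : measurableType d)
  (P : probability T R) (Z : T -> 'rV[R]_m).

Lemma sin_dilation_close (x A a : R) : 0 < a -> `|x| <= A ->
  `|x - a * sin (x / a)| <= A ^+ 3 / a ^+ 2.
Proof.
move=> a0 xA; rewrite (_ : x - _ = a * - (sin (x / a) - x / a)); last first.
  by field; rewrite gt_eqF.
rewrite normrM normrN gtr0_norm//.
apply: le_trans (ler_wpM2l (ltW a0) (sin_subid_le _)) _.
rewrite normrM normfV (gtr0_norm a0) expr_div_n.
rewrite (_ : a * (`|x| ^+ 3 / a ^+ 3) = `|x| ^+ 3 / a ^+ 2); last first.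
  by field; rewrite gt_eqF.
by rewrite ler_wpM2r ?invr_ge0 ?sqr_ge0// lerXn2r ?nnegrE// (le_trans _ xA).
Qed.

(** Dilation N+1 and accuracy 1/(N+1) are taken together: one sequence is then bounded on the whole
    space and converges uniformly on boxes, where the dilated sine is close to the identity. *)
Lemma trig_approx_seq (f : 'rV[R]_m -> R) (B : R) : continuous f ->
  (forall x, `|f x| <= B) ->
  exists2 p : nat -> 'rV[R]_m -> R,
    forall N, trig_poly (p N) /\ forall x, `|p N x| <= B + 1 &
    forall (A e : R), 0 < e -> \forall N \near \oo,
      forall x : 'rV[R]_m, (forall i, `|x ord0 i| <= A) -> `|f x - p N x| <= e.
Proof.
move=> cf fB.
have hN N : 0 < N.+1%:R^-1 :> R by rewrite invr_gt0.
have /choice[p pP] : forall N : nat, exists g, trig_poly g /\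
    forall x, `|g x - f (\row_i (N.+1%:R * sin (x ord0 i / N.+1%:R)))| <= N.+1%:R^-1.
  move=> N; have [g tg gP] := trig_poly_approx (N.+1%:R) cf fB (hN N).
  by exists g.
exists p.
  move=> N; have [tp pN] := pP N; split => // x.
  rewrite -[p N x](subrK (f (\row_i (N.+1%:R * sin (x ord0 i / N.+1%:R))))) addrC.
  apply: le_trans (ler_normD _ _) _; apply: lerD; first exact: fB.
  by apply: le_trans (pN x) _; rewrite invf_le1// ler1n.
move=> A e e0; have e2 : 0 < e / 2 by rewrite divr_gt0.
have [dl d0 dP] := box_unif_cont A cf e2.
near=> N => x xA.
(* The sign of A is known only through a coordinate, since m may be 0; hence the absolute value of A
   in the threshold for N. *)
have A0 (i : 'I_m) : 0 <= A by exact: le_trans (normr_ge0 _) (xA i).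
have [_ /(_ x) pN] := pP N.
rewrite (_ : f x - p N x = (f x - f (\row_i (N.+1%:R * sin (x ord0 i / N.+1%:R))))
   - (p N x - f (\row_i (N.+1%:R * sin (x ord0 i / N.+1%:R))))); last by ring.
apply: le_trans (ler_normB _ _) _; rewrite [e]splitr; apply: lerD; last first.
  apply: le_trans pN _; near: N.
  have := @cvg_harmonic R => /cvgrPdist_le /(_ _ e2).
  by apply: filterS => M; rewrite sub0r normrN gtr0_norm ?harmonic_gt0.
apply: dP => // i; rewrite mxE.
apply: le_lt_trans (sin_dilation_close _ (xA i)) _ => //.
rewrite ltr_pdivrMr ?exprn_gt0//.
apply: le_lt_trans (_ : `|A| ^+ 3 < _); first by rewrite ger0_norm// (A0 i).
rewrite -ltr_pdivrMl//.
apply: lt_le_trans (_ : N.+1%:R <= _); last first.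
  by rewrite expr2 ler_peMr// ler1n.
near: N; exists (Num.truncn (dl^-1 * `|A| ^+ 3)) => // N /= hM.
apply: lt_le_trans (truncnS_gt _) _.
by rewrite ler_nat ltnS.
Unshelve. all: by end_near.
Qed.

(** [E n] stands for expectation under the n-th law. The first moment bound provides tightness:
    outside a box of size A, |f - p N| is at most (2B+1)/A times the sum of the |x_i|, so f may be
    replaced by [p N] uniformly in large n. Dominated convergence makes the same replacement in the
    limit. *)
Lemma levy_continuity (E : nat -> ('rV[R]_m -> R) -> R) (C : R) (f : 'rV[R]_m -> R) :
  (forall n g h, E n (fun x => g x + h x) = E n g + E n h) ->
  (forall n a g, E n (fun x => a * g x) = a * E n g) ->
  (forall n a, E n (fun=> a) = a) ->
  (forall n g h, (forall x, g x <= h x) -> E n g <= E n h) ->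
  (\forall n \near \oo, forall i, E n (fun x => `|x ord0 i|) <= C) ->
  (forall i, measurable_fun setT (fun w => Z w ord0 i)) ->
  (forall s, exists2 c, 'E_P[fun w => cos (dotr s (Z w))]%E = c%:E &
     E^~ (fun x => cos (dotr s x)) @ \oo --> c) ->
  (forall s, exists2 c, 'E_P[fun w => sin (dotr s (Z w))]%E = c%:E &
     E^~ (fun x => sin (dotr s x)) @ \oo --> c) ->
  continuous f -> (exists B : R, forall x, `|f x| <= B) ->
  (fun n => (E n f)%:E) @ \oo --> 'E_P[fun w => f (Z w)]%E.
Proof.
move=> ED EZ Ec Ele EC mZ Hc Hs cf [B fB].
have mdot s : measurable_fun setT (fun w => dotr s (Z w)).
  by apply: measurable_sum => i; apply: measurable_funM.
have [p pP plim] := trig_approx_seq cf fB.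
have TP N := trig_poly_expectation ED EZ mdot Hc Hs (pP N).1.
have B0 : 0 <= B by exact: le_trans (fB 0).
have pcvg x : p ^~ x @ \oo --> f x.
  apply/cvgrPdist_le => e e0.
  near=> N; near: N.
  have := plim (\big[Order.max/0]_(i < m) `|x ord0 i|) e e0.
  by apply: filterS => N; apply => i; exact: le_bigmax.
have mf : measurable_fun setT (fun w => f (Z w)).
  apply: (measurable_fun_cvg (h := fun N w => p N (Z w))).
    by move=> N; have [] := TP N.
  by move=> w _; exact: pcvg.
have DCT : (fun N => 'E_P[p N \o Z]%E) @ \oo --> 'E_P[fun w => f (Z w)]%E.
  rewrite unlock.
  have [] // := @dominated_convergence _ T R P setT measurableT
    (fun N w => (p N (Z w))%:E) (fun w => (f (Z w))%:E) (fun=> (B + 1)%:E).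
  - by move=> N; apply/measurable_EFinP; have [] := TP N.
  - exact/measurable_EFinP.
  - by apply: aeW => w _; apply: cvg_EFin; [exact: nearW|exact: pcvg].
  - apply: (bounded_integrable P (X := fun=> (B + 1)%R) (B := B + 1)) => // w.
    by rewrite ger0_norm// addr_ge0.
  - by apply: aeW => w N _; rewrite lee_fin; exact: (pP N).2.
have If : 'E_P[fun w => f (Z w)]%E \is a fin_num.
  rewrite unlock; apply: integrable_fin_num => //.
  exact: (bounded_integrable P mf (fun w => fB (Z w))).
have /choice[cp Icp] : forall N : nat, exists c : R,
    'E_P[p N \o Z]%E = c%:E /\ E^~ (p N) @ \oo --> c.
  by move=> N; have [_ _ [c Ic Lc]] := TP N; exists c.
rewrite -(fineK If); apply: cvg_EFin; first exact: nearW.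
set If' := fine _.
have cpf : cp @ \oo --> If'.
  apply: (fine_cvg (f := fun N => (cp N)%:E)).
  rewrite fineK//; apply: cvg_trans DCT; apply: near_eq_cvg; apply: nearW => N.
  by rewrite (Icp N).1.
apply/cvgrPdist_le => e e0.
(* The size of the box makes the tail term at most e/4; the final + 1 keeps A positive. *)
pose A := (2 * B + 1) * m%:R * (`|C| + 1) / (e / 4) + 1.
have C0 : 0 < `|C| + 1 by rewrite ltr_wpDl.
have e4 : 0 < e / 4 by rewrite divr_gt0.
have A0 : 0 < A.
  rewrite ltr_wpDl// divr_ge0 ?mulr_ge0 ?addr_ge0 ?mulr_ge0//; exact: ltW.
have [N [NA Ncp]] : exists N, (forall x : 'rV[R]_m, (forall i, `|x ord0 i| <= A)
  -> `|f x - p N x| <= e / 4)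
   /\ `|If' - cp N| <= e / 4.
  have h1 := plim A _ e4.
  have /cvgrPdist_le/(_ _ e4) h2 := cpf.
  by have [N [? ?]] := filter_ex (filterI h1 h2); exists N.
have K0 : 0 <= (2 * B + 1) / A by apply: divr_ge0; [lra|exact: ltW].
have tail x : `|f x - p N x| <= e / 4 + (2 * B + 1) / A * \sum_(i < m) `|x ord0 i|.
  have S0 : 0 <= (2 * B + 1) / A * \sum_(i < m) `|x ord0 i|.
    by apply: mulr_ge0 => //; exact: sumr_ge0.
  have [xA|] := pselect (forall i, `|x ord0 i| <= A).
    by apply: le_trans (NA x xA) _; rewrite lerDl.
  move=> /existsNP[i /negP]; rewrite -ltNge => Ai.
  apply: le_trans (ler_normB _ _) _; apply: le_trans (lerD (fB x) ((pP N).2 x)) _.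
  rewrite (_ : B + (B + 1) = 0 + (2 * B + 1) / A * A); last first.
    by field; rewrite gt_eqF.
  apply: lerD; first exact: ltW.
  rewrite ler_wpM2l//.
  by rewrite (bigD1 i)//=; apply: ler_wpDr; [exact: sumr_ge0|exact: ltW].
have Esum n (r : seq 'I_m) : E n (fun x => \sum_(i <- r) `|x ord0 i|) = \sum_(i
  <- r) E n (fun x => `|x ord0 i|).
  elim: r => [|i r IH]; first by under eq_fun do rewrite big_nil; rewrite Ec big_nil.
  by under eq_fun do rewrite big_cons; rewrite ED IH big_cons.
near=> n.
have ECn : forall i, E n (fun x => `|x ord0 i|) <= C by near: n.
have Ecp : `|cp N - E n (p N)| <= e / 4.
  by near: n; have [_ /cvgrPdist_le/(_ _ e4)] := Icp N.
have tot : E n (fun x => e / 4 + (2 * B + 1) / A * \sum_(i < m) `|x ord0 i|) <= e / 2.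
  rewrite ED Ec EZ Esum.
  suff : (2 * B + 1) / A * \sum_(i < m) E n (fun x => `|x ord0 i|) <= e / 4 by lra.
  apply: le_trans (_ : (2 * B + 1) / A * \sum_(i < m) (`|C| + 1) <= _).
    rewrite ler_wpM2l//.
    apply: ler_sum => i _; apply: le_trans (ECn i) _.
    by apply: le_trans (ler_norm _) _; rewrite lerDl.
  rewrite sumr_const card_ord -mulr_natl.
  rewrite (_ : _ * _ = (2 * B + 1) * m%:R * (`|C| + 1) / A); last by ring.
  rewrite ler_pdivrMr// /A.
  set X := (2 * B + 1) * _ * _.
  rewrite [leRHS](_ : _ = X + e / 4); last by field; rewrite gt_eqF.
  by rewrite lerDl ltW.
have Efp : `|E n f - E n (p N)| <= e / 2.
  have EB : E n f - E n (p N) = E n (fun x => f x + -1 * p N x) by rewrite ED EZ mulN1r.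
  rewrite EB ler_norml; apply/andP; split; last first.
    by apply: le_trans tot; apply: Ele => x; rewrite mulN1r (le_trans (ler_norm _)).
  rewrite lerNl -[leLHS]mulN1r -EZ; apply: le_trans tot; apply: Ele => x.
  by rewrite !mulN1r (le_trans (ler_norm _))// normrN.
rewrite (_ : If' - E n f = (If' - cp N) + (cp N - E n (p N)) - (E n f - E n (p
  N))); last by ring.
apply: le_trans (ler_normB _ _) _; apply: le_trans (lerD (ler_normD _ _) (lexx _)) _.
by lra.
Unshelve. all: by end_near.
Qed.

End Levy.

(** * Variance of the linear part and normalization *)

Section HarmonicSums.
Context {R : realType}.
Implicit Types (n r : nat).

Lemma ln_le_hsum n : ln n.+1%:R <= hsum n :> R.
Proof.
elim: n => [|n IH]; first by rewrite ln1 hsum0.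
have n0 : 0 < n.+1%:R :> R by [].
rewrite hsumS (_ : n.+2%:R = n.+1%:R * (1 + n.+1%:R^-1)); last first.
  by rewrite mulrDr mulr1 divff ?gt_eqF// natr1.
have i0 : 0 < n.+1%:R^-1 :> R by rewrite invr_gt0.
rewrite lnM ?posrE ?addr_gt0// lerD// le_ln1Dx//.
by apply: lt_trans i0; lra.
Qed.

Lemma hsum_le_ln n : (0 < n)%N -> hsum n <= ln n%:R + 1 :> R.
Proof.
case: n => // n _; elim: n => [|n IH]; first by rewrite hsumS hsum0 ln1 invr1.
rewrite hsumS; apply: le_trans (lerD IH (lexx _)) _.
have n0 : 0 < n.+1%:R :> R by [].
have m0 : 0 < n.+2%:R :> R by [].
have E : n.+1%:R = n.+2%:R * (1 + - n.+2%:R^-1) :> R.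
  by rewrite mulrDr mulr1 mulrN divff ?gt_eqF// -[n.+2%:R]natr1 addrK.
have i1 : n.+2%:R^-1 < 1 :> R by rewrite invf_lt1// ltr1n.
rewrite {1}E lnM ?posrE ?subr_gt0//.
have : ln (1 + - n.+2%:R^-1) <= - n.+2%:R^-1 :> R by rewrite le_ln1Dx// ltrN2.
move: (ln (1 - _)) => a; move: (ln _) => b; move: (_^-1) => c; lra.
Qed.

(** As i runs from 0 to n these points decrease from 1 to 0 in steps 1/((i+1) H_n), a partition of
    [0,1]. *)
Definition xrest n i : R := @hrest R n i / hsum n.

Lemma xrest_ge0 n i : (i <= n)%N -> 0 <= xrest n i.
Proof. by move=> ni; rewrite divr_ge0 ?hsum_ge0 ?hrest_ge0. Qed.

Lemma xrest_le1 n i : (0 < n)%N -> xrest n i <= 1.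
Proof.
by move=> n0; rewrite ler_pdivrMr ?hsum_gt0// mul1r /hrest gerBl hsum_ge0.
Qed.

Lemma xrestS n i : xrest n i = xrest n i.+1 + i.+1%:R^-1 / hsum n.
Proof. by rewrite /xrest hrestS mulrDl. Qed.

Lemma xrest0 n : (0 < n)%N -> xrest n 0 = 1.
Proof. by move=> n0; rewrite /xrest /hrest hsum0 subr0 divff// gt_eqF ?hsum_gt0. Qed.

Lemma xrestn n : xrest n n = 0.
Proof. by rewrite /xrest /hrest subrr mul0r. Qed.

(** Up to the factor H_n, the left side is the lower Riemann sum of the integral of x^r over
    [0,1]. *)
Lemma xrest_sum_le n r : (0 < n)%N ->
  \sum_(0 <= i < n) xrest n i.+1 ^+ r / i.+1%:R <= hsum n / r.+1%:R.
Proof.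
move=> n0; have H0 := @hsum_gt0 R n n0.
rewrite ler_pdivlMr// mulr_suml.
apply: le_trans (_ : \sum_(0 <= i < n) hsum n * (xrest n i ^+ r.+1 - xrest n i.+1
  ^+ r.+1) <= _).
  rewrite !big_nat; apply: ler_sum => i /andP[_ ni].
  have i0 : 0 <= i.+1%:R^-1 / hsum n :> R by rewrite divr_ge0 ?invr_ge0 ?ltW.
  have := exprD_ge_linear r (xrest_ge0 ni) i0; rewrite -xrestS => h.
  rewrite -ler_pdivrMl//; apply: le_trans (_ : r.+1%:R * (i.+1%:R^-1 / hsum n) *
    xrest n i.+1 ^+ r <= _).
    by rewrite le_eqVlt; apply/orP; left; apply/eqP; ring.
  by rewrite lerBrDl.
rewrite -mulr_sumr -{2}[hsum n]mulr1; apply: ler_wpM2l; first exact: ltW.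
under eq_bigr do rewrite -opprB.
rewrite sumrN telescope_sumr// opprB xrest0// xrestn expr1n expr0n subr0//.
Qed.

(** The upper Riemann sum, with x_i in place of x_(i+1), is at least the integral; the two sums
    differ by a telescoping quantity at most 1. *)
Lemma xrest_sum_ge n r : (0 < n)%N ->
  hsum n / r.+1%:R - 1 <= \sum_(0 <= i < n) xrest n i.+1 ^+ r / i.+1%:R.
Proof.
move=> n0; have H0 := @hsum_gt0 R n n0.
have xle i : xrest n i.+1 <= xrest n i.
  by rewrite [leRHS]xrestS lerDl; apply: divr_ge0; [rewrite invr_ge0|exact: ltW].
have tel q : \sum_(0 <= i < n) (xrest n i ^+ q - xrest n i.+1 ^+ q) = 1 - xrest n
  n ^+ q.
  under eq_bigr do rewrite -opprB.
  by rewrite sumrN telescope_sumr// opprB xrest0// expr1n.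
have A : hsum n / r.+1%:R <= \sum_(0 <= i < n) xrest n i ^+ r / i.+1%:R.
  rewrite ler_pdivrMr// mulr_suml -{1}[hsum n]mulr1.
  have one : 1 = \sum_(0 <= i < n) (xrest n i ^+ r.+1 - xrest n i.+1 ^+ r.+1).
    by rewrite tel xrestn expr0n subr0.
  rewrite [X in _ * X <= _]one mulr_sumr.
  rewrite !big_nat; apply: ler_sum => i /andP[_ ni].
  rewrite -ler_pdivlMl//; apply: le_trans (subrX_le _ (xrest_ge0 ni) (xle i)) _.
  rewrite [X in _ * (X - _) * _]xrestS addrAC subrr add0r.
  by rewrite le_eqVlt; apply/orP; left; apply/eqP; ring.
apply: le_trans (lerD A (lexx _)) _; rewrite lerBlDr -lerBlDl -sumrB.
apply: le_trans (_ : \sum_(0 <= i < n) (xrest n i ^+ r - xrest n i.+1 ^+ r) <= _).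
  rewrite !big_nat; apply: ler_sum => i /andP[_ ni].
  rewrite -mulrBl ler_piMr ?invf_le1 ?ler1n// subr_ge0.
  by rewrite lerXn2r ?nnegrE ?xrest_ge0// ltnW.
by rewrite tel gerBl exprn_ge0// xrestn.
Qed.

Definition xvar n r : R :=
  \sum_(0 <= i < n) xrest n i.+1 ^+ r * (i.+1%:R^-1 * (1 - i.+1%:R^-1)).

(** The factor 1 - 1/(i+1) costs at most the sum of the 1/(i+1)^2, which is at most 2. *)
Lemma xrest_sum_xvar n r : (0 < n)%N ->
  xvar n r <= \sum_(0 <= i < n) xrest n i.+1 ^+ r / i.+1%:R <= xvar n r + 2.
Proof.
move=> n0.
have -> : \sum_(0 <= i < n) xrest n i.+1 ^+ r / i.+1%:R = xvar n r
    + \sum_(0 <= i < n) xrest n i.+1 ^+ r * i.+1%:R^-1 ^+ 2.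
  rewrite /xvar -big_split; apply: eq_bigr => i _ /=; ring.
rewrite lerDl lerD2l; apply/andP; split.
  by rewrite big_nat sumr_ge0// => i /andP[_ ni]; rewrite mulr_ge0 ?sqr_ge0
    ?exprn_ge0 ?xrest_ge0.
apply: le_trans (sum_inv_sq_le n); rewrite !big_nat; apply: ler_sum => i /andP[_ ni].
by rewrite ler_piMl ?sqr_ge0// exprn_ile1 ?xrest_ge0 ?xrest_le1.
Qed.

Lemma xvar_bounds n r : (0 < n)%N ->
  hsum n / r.+1%:R - 3 <= xvar n r <= hsum n / r.+1%:R.
Proof.
move=> n0; have /andP[h1 h2] := xrest_sum_xvar r n0.
have h3 := xrest_sum_le r n0; have h4 := xrest_sum_ge r n0.
move: h1 h2 h3 h4; move: (\sum_(0 <= i < n) _) (xvar n r) (hsum n / _) => a b c *.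
by apply/andP; split; lra.
Qed.

End HarmonicSums.

(** * From harmonic numbers to logarithms *)

Section Normalization.
Context {R : realType}.
Implicit Types (k : nat -> R) (u : R) (n : nat).

(** The ratio between the normalization of [Yn], in powers of ln n, and the factor K!/H_n^K of
    [level_count_linear]. *)
Definition rscale k n (K : nat) : R :=
  Num.sqrt ((Num.truncn (k n))%:R / ln n%:R) * (hsum n / ln n%:R) ^+ K.

Definition rlevel k n u : nat := (Num.truncn (k n * u)).-1.

Lemma root_sum_sq n (C : nat -> R) :
  rrt_expect (fun t : rtree_code n => root_sum C n (rdepth t) ^+ 2)
    <= \sum_(0 <= i < n) C i ^+ 2 / i.+1%:R.
Proof.
pose g i d : R := C i * (d == 1%N)%:R.
rewrite [leLHS](_ : _ = rrt_expect (fun t : rtree_code n =>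
    (\sum_(0 <= i < n) noise (g i) i (rdepth t)) ^+ 2)); last first.
  apply: eq_rrt_expect => t _; congr (_ ^+ 2); apply: eq_bigr => i _.
  rewrite /noise /g -mulr_sumr mulrCA -mulrBr; congr (_ * (_ - _)).
  rewrite big_nat_recl//= big1 ?addr0 ?mulr1// => j _.
apply: le_trans (noise_sum_second_moment g (leqnn n)) _.
rewrite !big_nat; apply: ler_sum => i /andP[_ ni].
have g0 d : (1 <= d)%N -> g i d.+1 = 0 by case: d => // d _; rewrite /g mulr0.
apply: le_trans (expect_sq_depth ni g0) _.
by rewrite big_ord1 /g eqxx mulr1 dpow0 mulr1 mulrC.
Qed.

(** The constant is the 9 of [level_count_linear] plus 1 for recentering at a power of ln n instead
    of H_n. *)
Lemma Yn_linear k n u : (2 <= rlevel k n u)%N -> 0 < ln n%:R :> R -> (0 < n)%N ->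
  (rlevel k n u)%:R / hsum n <= 2^-1 :> R ->
  rrt_expect (fun t : rtree_code n => `|Yn k u t - rscale k n (rlevel k n u)
      * root_sum (fun i => xrest n i.+1 ^+ rlevel k n u) n (rdepth t)|)
   <= 10 * rscale k n (rlevel k n u).
Proof.
move=> K2 L0 n0 KH; set K := rlevel k n u in K2 KH *.
have KE : Num.truncn (k n * u) = K.+1.
  by move: K2; rewrite /K /rlevel; case: (Num.truncn _).
have H0 := @hsum_gt0 R n n0.
have b0 : 0 <= rscale k n K.
  by rewrite mulr_ge0 ?sqrtr_ge0// exprn_ge0// divr_ge0// ltW.
have YE (t : rtree_code n) : Yn k u t = rscale k n K * (K`!%:R / hsum n ^+ K *
    ((level_count t K.+1)%:R - ln n%:R ^+ K.+1 / K.+1`!%:R)).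
  rewrite /Yn KE /=.
  have -> : ln n%:R `^ (K.+1%:R - 2^-1) = ln n%:R ^+ K * Num.sqrt (ln n%:R) :> R.
    rewrite (_ : K.+1%:R - 2^-1 = K%:R + 2^-1); last by rewrite -natr1; lra.
    by rewrite powRD ?powR_mulrn ?powR12_sqrt ?ltW// gt_eqF ?implybT.
  rewrite /rscale sqrtrM// sqrtrV ?ltW// expr_div_n.
  have s0 : Num.sqrt (ln n%:R) != 0 :> R by rewrite gt_eqF ?sqrtr_gt0.
  have lK : ln n%:R ^+ K != 0 :> R by rewrite expf_neq0// gt_eqF.
  have hK : hsum n ^+ K != 0 :> R by rewrite expf_neq0// gt_eqF.
  move: (_ - _ / _) => X; move: (Num.sqrt (ln _)) (ln n%:R ^+ K) (hsum n ^+ K) s0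
    lK hK => a b c a0 bn0 c0.
  by field; rewrite a0 bn0 c0.
(* The recentering error lies in [0,1] because 0 <= H_n - ln n <= 1 and y^(K+1) - z^(K+1) <= (K+1)(y
   - z) y^K. *)
pose e : R := K`!%:R / hsum n ^+ K * (dpow K.+1 (hsum n) - ln n%:R ^+ K.+1 / K.+1`!%:R).
have e01 : 0 <= e <= 1.
  have hL : ln n%:R <= hsum n :> R.
    apply: le_trans (ln_le_hsum n); rewrite ler_ln ?posrE ?ltr0n// ler_nat//.
  have eE : e = (hsum n ^+ K.+1 - ln n%:R ^+ K.+1) / (K.+1%:R * hsum n ^+ K).
    rewrite /e /dpow factS natrM.
    have f0 : (K`!%:R : R) != 0 by rewrite pnatr_eq0 -lt0n fact_gt0.
    have hK : hsum n ^+ K != 0 :> R by rewrite expf_neq0// gt_eqF.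
    have k0 : K.+1%:R != 0 :> R by [].
    move: (hsum n ^+ K) (K.+1%:R : R) (K`!%:R : R) hK k0 f0 => a b c a0 bn0 c0.
    by field; rewrite a0 bn0 c0.
  have d0 : 0 < K.+1%:R * hsum n ^+ K :> R by rewrite mulr_gt0// exprn_gt0.
  rewrite eE divr_ge0 ?(ltW d0) ?subr_ge0 ?lerXn2r ?nnegrE ?(ltW L0) ?(ltW H0)//=.
  rewrite ler_pdivrMr// mul1r; apply: le_trans (subrX_le _ (ltW L0) hL) _.
  rewrite ler_wpM2r ?exprn_ge0 ?(ltW H0)// -[leRHS]mulr1 ler_wpM2l// lerBlDl.
  exact: hsum_le_ln.
have := level_count_linear K2 H0 KH.
set F := fun t : rtree_code n => _ => hF.
apply: le_trans (_ : rrt_expect (fun t => rscale k n K * (F t + 1)) <= _); last first.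
  rewrite rrt_expectZ rrt_expectD rrt_expect_cst mulrC ler_wpM2r//.
  by rewrite /F; lra.
apply: rrt_expect_le => t _; rewrite YE -mulrBr normrM (ger0_norm b0) ler_wpM2l//.
rewrite [X in `|X|](_ : _ = (K`!%:R / hsum n ^+ K * ((level_count t K.+1)%:R -
  dpow K.+1 (hsum n)) - root_sum (fun i : nat => xrest n i.+1 ^+ K) n (rdepth t))
  + e); last first.
  by rewrite /e; ring.
apply: le_trans (ler_normD _ _) _; apply: lerD; first exact: lexx.
by have /andP[e0 e1] := e01; rewrite ger0_norm.
Qed.

End Normalization.

(** * Asymptotics of the normalizing constants *)

Section SequenceLimits.
Context {R : realType}.

Lemma cvg_near_dist (a b c : nat -> R) (l : R) :
  (\forall n \near \oo, `|a n - b n| <= c n) -> c @ \oo --> (0 : R) ->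
  b @ \oo --> l -> a @ \oo --> l.
Proof.
move=> abc c0 bl.
apply: (@squeeze_cvgr _ _ _ _ (fun n => b n - c n) (fun n => b n + c n)).
- by apply: filterS abc => n; rewrite ler_norml => /andP[h1 h2]; apply/andP; split; lra.
- by rewrite -[l]subr0; apply: cvgB.
- by rewrite -[l]addr0; apply: cvgD.
Qed.

Lemma cvg_near_eq (a b : nat -> R) (l : R) :
  (\forall n \near \oo, a n = b n) -> b @ \oo --> l -> a @ \oo --> l.
Proof.
move=> ab; apply: cvg_near_dist (cvg_cst 0).
by apply: filterS ab => n ->; rewrite subrr normr0.
Qed.

Lemma cvg_seq_sum (I : Type) (r : seq I) (a : I -> nat -> R) (l : I -> R) :
  (forall i, a i @ \oo --> l i) ->
  (fun n => \sum_(i <- r) a i n) @ \oo --> \sum_(i <- r) l i.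
Proof.
move=> al; elim: r => [|i r IH].
  by rewrite big_nil; under eq_fun do rewrite big_nil; exact: cvg_cst.
by rewrite big_cons; under eq_fun do rewrite big_cons; exact: cvgD.
Qed.

Lemma truncn_dist (x : R) : 0 <= x -> `|(Num.truncn x)%:R - x| <= 1.
Proof.
move=> /truncn_itv; rewrite -natr1 => /andP[h1 h2].
by rewrite ler_norml; apply/andP; split; lra.
Qed.

End SequenceLimits.

Section Scaling.
Context {R : realType} (k : nat -> R).
Local Notation L n := (ln n%:R : R).

Definition slow_divergence : Prop :=
  [/\ forall n, 0 < k n, forall A, \forall n \near \oo, A <= k n &
    forall e, 0 < e -> \forall n \near \oo, `|k n| <= e * `|L n|].

Context (hk : slow_divergence).

Lemma near_le_ln (A : R) : \forall n \near \oo, (0 < n)%N /\ A <= L n.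
Proof.
case: hk => k0 kinf klit.
near=> n.
have n0 : (0 < n)%N by near: n; exists 1%N.
split => //; have L0 : 0 <= L n by rewrite ln_ge0// ler1n.
have h1 : A <= k n by near: n; exact: kinf.
have h2 : `|k n| <= 1 * `|L n| by near: n; exact: klit.
by apply: le_trans h1 _; rewrite mul1r (gtr0_norm (k0 n)) (ger0_norm L0) in h2.
Unshelve. all: by end_near.
Qed.

Lemma cvg_inv_ln : (fun n => (L n)^-1) @ \oo --> (0 : R).
Proof.
apply/cvgrPdist_le => e e0.
apply: filterS (near_le_ln e^-1) => n [n0 h].
have L0 : 0 < L n by apply: lt_le_trans h; rewrite invr_gt0.
by rewrite sub0r normrN gtr0_norm ?invr_gt0// invf_ple ?posrE.
Qed.

Lemma cvg_inv_k : (fun n => (k n)^-1) @ \oo --> (0 : R).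
Proof.
case: hk => k0 kinf _.
apply/cvgrPdist_le => e e0; apply: filterS (kinf e^-1) => n h.
by rewrite sub0r normrN gtr0_norm ?invr_gt0// invf_ple ?posrE.
Qed.

Lemma cvg_k_ln : (fun n => k n / L n) @ \oo --> (0 : R).
Proof.
case: hk => k0 _ klit.
apply/cvgrPdist_le => e e0; near=> n.
have [n0 L1] : (0 < n)%N /\ 1 <= L n by near: n; exact: near_le_ln.
have L0 : 0 < L n by exact: lt_le_trans L1.
rewrite sub0r normrN normrM normfV ler_pdivrMr ?normr_gt0 ?gt_eqF//.
by near: n; exact: klit.
Unshelve. all: by end_near.
Qed.

Lemma cvg_trunc_k (c : R) : 0 < c ->
  (fun n => (Num.truncn (k n * c))%:R / k n) @ \oo --> c.
Proof.
case: hk => k0 _ _ c0.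
apply: (cvg_near_dist (b := fun=> c) (c := fun n => (k n)^-1)); last exact: cvg_cst.
  apply: nearW => n; have kn := k0 n.
  rewrite (_ : _ - c = ((Num.truncn (k n * c))%:R - k n * c) / k n); last first.
    by field; rewrite gt_eqF.
  rewrite normrM normfV (gtr0_norm kn) ler_piMl ?invr_ge0 ?(ltW kn)//.
  by rewrite truncn_dist// mulr_ge0// ltW.
exact: cvg_inv_k.
Qed.

(** Squeezing: 1 <= H_n/ln n <= 1 + 1/ln n <= exp(1/ln n), so the power is at most exp(q/ln n). *)
Lemma cvg_hsum_ratio (q : nat -> nat) :
  (fun n => (q n)%:R / L n) @ \oo --> (0 : R) ->
  (fun n => (hsum n / L n) ^+ q n) @ \oo --> (1 : R).
Proof.
move=> q0; apply: (@squeeze_cvgr _ _ _ _ (fun=> 1) (fun n => expR ((q n)%:R / L n))).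
- apply: filterS (near_le_ln 1) => n [n0 L1].
  have L0 : 0 < L n by exact: lt_le_trans L1.
  have LH : L n <= hsum n.
    by apply: le_trans (ln_le_hsum n); rewrite ler_ln ?posrE ?ltr0n// ler_nat.
  have r1 : 1 <= hsum n / L n by rewrite ler_pdivlMr// mul1r.
  rewrite exprn_ege1//= [(q n)%:R / _]mulrC expRM_natr lerXn2r ?nnegrE ?expR_ge0//.
    exact: le_trans r1.
  apply: le_trans (expR_ge1Dx _); rewrite ler_pdivrMr// mulrDl mul1r mulVf ?gt_eqF//.
  exact: hsum_le_ln.
- exact: cvg_cst.
- rewrite -[X in _ --> X](expR0 R); apply: (@continuous_cvg _ _ _ _ _ _ (@expR
    R)) => //; exact: continuous_expR.
Qed.

Lemma rlevel_near (c : R) : 0 < c -> \forall n \near \oo,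
  (2 <= rlevel k n c)%N /\ Num.truncn (k n * c) = (rlevel k n c).+1.
Proof.
case: hk => k0 kinf _ c0.
(* The threshold 3/c makes the integer part at least 3, so its predecessor is genuine and at least
   2. *)
apply: filterS (kinf (3 / c)) => n; rewrite ler_pdivrMr// => h.
have : (3 <= Num.truncn (k n * c))%N by rewrite truncn_ge_nat// mulr_ge0 ?ltW.
by rewrite /rlevel; case: (Num.truncn _) => // t; rewrite ltnS.
Qed.

Lemma rlevel_le (n : nat) (c : R) : 0 < c -> (rlevel k n c)%:R <= k n * c.
Proof.
case: hk => k0 _ _ c0; apply: le_trans (_ : (Num.truncn (k n * c))%:R <= _).
  by rewrite ler_nat leq_pred.
by rewrite truncn_le mulr_ge0 ?ltW.
Qed.

Lemma cvg_rlevel_ln (c : R) : 0 < c ->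
  (fun n => (rlevel k n c)%:R / L n) @ \oo --> (0 : R).
Proof.
move=> c0.
apply: (@squeeze_cvgr _ _ _ _ (fun=> 0) (fun n => c * (k n / L n))).
- apply: filterS (near_le_ln 1) => n [n0 L1].
  have L0 : 0 < L n by exact: lt_le_trans L1.
  rewrite divr_ge0 ?(ltW L0)//= mulrA [c * _]mulrC.
  by rewrite ler_wpM2r ?invr_ge0 ?(ltW L0)// rlevel_le.
- exact: cvg_cst.
- by rewrite -(mulr0 c); apply: cvgMl_tmp; exact: cvg_k_ln.
Qed.

Lemma cvg_kappa_ln : (fun n => (Num.truncn (k n))%:R / L n) @ \oo --> (0 : R).
Proof.
apply: (@squeeze_cvgr _ _ _ _ (fun=> 0) (fun n => k n / L n)).
- apply: filterS (near_le_ln 1) => n [n0 L1].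
  have L0 : 0 < L n by exact: lt_le_trans L1.
  have k0 : 0 <= k n by case: hk => k0 _ _; rewrite ltW.
  rewrite divr_ge0 ?(ltW L0)//=.
  by rewrite ler_wpM2r ?invr_ge0 ?(ltW L0)// truncn_le.
- exact: cvg_cst.
- exact: cvg_k_ln.
Qed.

Lemma cvg_rscale (c : R) : 0 < c ->
  (fun n => rscale k n (rlevel k n c)) @ \oo --> (0 : R).
Proof.
move=> c0; rewrite -(mulr1 0); apply: cvgM; last first.
  by apply: cvg_hsum_ratio; exact: cvg_rlevel_ln.
rewrite -(sqrtr0 R); apply: (@continuous_cvg _ _ _ _ _ _ (@Num.sqrt R)); last
  exact: cvg_kappa_ln.
exact: sqrt_continuous.
Qed.

Lemma rscale_ge0 n K : (0 < n)%N -> 0 <= rscale k n K.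
Proof.
move=> n0; rewrite mulr_ge0 ?sqrtr_ge0// exprn_ge0// divr_ge0 ?hsum_ge0//.
by rewrite ln_ge0// ler1n.
Qed.

Lemma cvg_kappa_rlevel (u v : R) : 0 < u -> 0 < v ->
  (fun n => (Num.truncn (k n))%:R / (rlevel k n u + rlevel k n v).+1%:R)
    @ \oo --> (u + v)^-1.
Proof.
move=> u0 v0; have k0 : forall n, 0 < k n by case: hk.
(* Numerator and denominator are divided by k_n; the denominator is [k_n u] + [k_n v] - 1. *)
apply: (cvg_near_eq (b := fun n => ((Num.truncn (k n * 1))%:R / k n) *
   ((Num.truncn (k n * u))%:R / k n + (Num.truncn (k n * v))%:R / k n - (k n)^-1)^-1)).
  near=> n.
  have [_ ->] : (2 <= rlevel k n u)%N /\ Num.truncn (k n * u) = (rlevel k n u).+1.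
    by near: n; exact: rlevel_near.
  have [_ ->] : (2 <= rlevel k n v)%N /\ Num.truncn (k n * v) = (rlevel k n v).+1.
    by near: n; exact: rlevel_near.
  rewrite mulr1 -[(_ + _).+1%:R]natr1 natrD -[(rlevel k n u).+1%:R]natr1
    -[(rlevel k n v).+1%:R]natr1.
  have a0 : 0 <= (rlevel k n u)%:R :> R by [].
  have b0 : 0 <= (rlevel k n v)%:R :> R by [].
  move: (_%:R) (_%:R) a0 b0 => a b a0 b0.
  have kn := k0 n.
  field; rewrite !gt_eqF//=; lra.
rewrite -[(u + v)^-1]mul1r -[u + v]subr0; apply: cvgM; first exact: cvg_trunc_k.
apply: cvgV; first by rewrite subr0 gt_eqF// addr_gt0.
by apply: cvgB; [apply: cvgD; exact: cvg_trunc_k|exact: cvg_inv_k].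
Unshelve. all: by end_near.
Qed.

(** [xvar] is H_n/q up to an error 3, negligible against the vanishing scales. The main term is
    exactly [k_n]/q times (H_n/ln n)^q. *)
Lemma cvg_covariance (u v : R) : 0 < u -> 0 < v ->
  (fun n => rscale k n (rlevel k n u) * rscale k n (rlevel k n v)
     * xvar n (rlevel k n u + rlevel k n v)) @ \oo --> (u + v)^-1.
Proof.
move=> u0 v0.
pose b n := rscale k n (rlevel k n u) * rscale k n (rlevel k n v).
pose q n := (rlevel k n u + rlevel k n v).+1.
have bcvg : b @ \oo --> (0 : R).
  by rewrite -(mulr0 0); apply: cvgM; exact: cvg_rscale.
have qcvg : (fun n => (q n)%:R / L n) @ \oo --> (0 : R).
  rewrite /q; under eq_fun do rewrite -natr1 natrD !mulrDl mul1r.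
  rewrite -[0]addr0; apply: cvgD; last exact: cvg_inv_ln.
  by rewrite -[0]addr0; apply: cvgD; exact: cvg_rlevel_ln.
apply: (cvg_near_dist (c := fun n => 3 * b n)
  (b := fun n => (Num.truncn (k n))%:R / (q n)%:R * (hsum n / L n) ^+ q n)).
- apply: filterS (near_le_ln 1) => n [n0 L1].
  have L0 : 0 < L n by exact: lt_le_trans L1.
  have b0 : 0 <= b n by rewrite mulr_ge0 ?rscale_ge0.
  have -> : (Num.truncn (k n))%:R / (q n)%:R * (hsum n / L n) ^+ q n
      = b n * (hsum n / (q n)%:R).
    rewrite /b /rscale [X in _ = X * _]mulrACA -exprD -expr2 sqr_sqrtr ?divr_ge0
      ?(ltW L0)//.
    by rewrite /q exprS; ring.
  rewrite -mulrBr normrM (ger0_norm b0) [leRHS]mulrC ler_wpM2l//.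
  have /andP[h1 h2] := @xvar_bounds R n (rlevel k n u + rlevel k n v) n0.
  rewrite -/(q n) in h1 h2 *; rewrite ler_norml.
  move: h1 h2; move: (xvar _ _) (hsum n / _) => x y *.
  by apply/andP; split; lra.
- by rewrite -(mulr0 3); apply: cvgMl_tmp.
- by rewrite -[(u + v)^-1]mulr1; apply: cvgM; [exact: cvg_kappa_rlevel|exact:
    cvg_hsum_ratio].
Qed.

End Scaling.

(** * Finite-dimensional convergence *)

Section FiniteDimensional.
Context {R : realType} (k : nat -> R) (hk : slow_divergence k)
  (m : nat) (u : 'I_m -> R) (u_pos : forall i, 0 < u i).
Local Notation b n i := (rscale k n (rlevel k n (u i))).
Local Notation x n i := (fun j : nat => @xrest R n j.+1 ^+ rlevel k n (u i)).

Lemma near_linear : \forall n \near \oo, forall i,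
  rrt_expect (fun t : rtree_code n => `|Yn k (u i) t - b n i * root_sum (x n i) n
    (rdepth t)|)
   <= 10 * b n i.
Proof.
have half0 : 0 < 2^-1 :> R by rewrite invr_gt0.
apply: filter_forall => i; near=> n.
have [n0 L1] : (0 < n)%N /\ 1 <= ln n%:R :> R by near: n; exact: (near_le_ln hk).
have L0 : 0 < ln n%:R :> R by exact: lt_le_trans L1.
have [K2 _] : (2 <= rlevel k n (u i))%N /\ Num.truncn (k n * u i) = (rlevel k n
  (u i)).+1.
  by near: n; exact: (rlevel_near hk).
apply: Yn_linear => //.
have LH : ln n%:R <= hsum n :> R.
  by apply: le_trans (ln_le_hsum n); rewrite ler_ln ?posrE ?ltr0n// ler_nat.
apply: le_trans (_ : (rlevel k n (u i))%:R / ln n%:R <= _).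
  by rewrite ler_wpM2l// lef_pV2 ?posrE// hsum_gt0.
near: n; exact: (cvgr_le _ (cvg_rlevel_ln hk (u_pos i)) _ half0).
Unshelve. all: by end_near.
Qed.

(** This is the tightness input. The linear approximation costs 10; |a| <= 1 + a^2 adds 1, the error
    between [xvar] and the second moment adds 2, and the distance of the scaled variance to its
    limit adds 1. *)
Lemma near_first_moment : \forall n \near \oo, forall i,
  rrt_expect (fun t : rtree_code n => `|Yn k (u i) t|)
    <= 14 + \sum_(j < m) (u j + u j)^-1.
Proof.
have h := near_linear; apply: filter_forall => i; near=> n.
have [n0 _] : (0 < n)%N /\ 1 <= ln n%:R :> R by near: n; exact: (near_le_ln hk).
have b0 : 0 <= b n i by exact: rscale_ge0.
have b1 : b n i <= 1.
  by near: n; exact: (cvgr_le _ (cvg_rscale hk (u_pos i)) _ ltr01).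
have hi : rrt_expect (fun t : rtree_code n => `|Yn k (u i) t - b n i * root_sum
  (x n i) n (rdepth t)|)
   <= 10 * b n i by near: n; apply: filterS h => n; exact.
have hv : b n i * b n i * xvar n (rlevel k n (u i) + rlevel k n (u i)) <= (u i +
  u i)^-1 + 1.
  near: n; apply: (cvgr_le _ (cvg_covariance hk (u_pos i) (u_pos i))).
  by rewrite ltrDl.
have ui : (u i + u i)^-1 <= \sum_(j < m) (u j + u j)^-1.
  rewrite (bigD1 i)//= lerDl sumr_ge0// => j _.
  by rewrite invr_ge0 addr_ge0// ltW.
apply: le_trans (_ : rrt_expect (fun t : rtree_code n => `|Yn k (u i) t - b n i *
  root_sum (x n i) n (rdepth t)|
   + (1 + b n i * b n i * root_sum (x n i) n (rdepth t) ^+ 2)) <= _).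
  apply: rrt_expect_le => t _.
  rewrite -{1}[Yn _ _ _](subrK (b n i * root_sum (x n i) n (rdepth t))).
  apply: le_trans (ler_normD _ _) _; rewrite lerD2l -expr2 -exprMn.
  rewrite -[X in _ <= 1 + X]real_normK ?num_real//; move: `|_| => a.
  by have := sqr_ge0 (a - 1); have := sqr_ge0 a; nra.
rewrite !rrt_expectD rrt_expectZ rrt_expect_cst.
have S1 := @root_sum_sq R n (x n i).
have /andP[_ S2] := @xrest_sum_xvar R n (rlevel k n (u i) + rlevel k n (u i)) n0.
have S3 : rrt_expect (fun t : rtree_code n => root_sum (x n i) n (rdepth t) ^+ 2)
    <= xvar n (rlevel k n (u i) + rlevel k n (u i)) + 2 :> R.
  apply: (le_trans S1); apply: (le_trans _ S2); rewrite le_eqVlt; apply/orP;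
    left; apply/eqP.
  by apply: eq_bigr => j _; rewrite expr2 -exprD.
have bb0 : 0 <= b n i * b n i by rewrite mulr_ge0.
have bb1 : b n i * b n i <= 1 by rewrite mulr_ile1.
have := ler_wpM2l bb0 S3; rewrite mulrDr; lra.
Unshelve. all: by end_near.
Qed.

Context (s : 'rV[R]_m).

Definition total_scale n : R := \sum_(i < m) `|s ord0 i| * b n i.
Definition total_coef n (j : nat) : R := \sum_(i < m) s ord0 i * b n i * x n i j.
Definition limit_var : R := \sum_(i < m) \sum_(j < m) s ord0 i * s ord0 j * (u i
  + u j)^-1.

(** A linear combination over the levels is again one weighted sum over the vertices, so the
    one-dimensional estimate [root_sum_char] settles the joint law. *)
Lemma root_sum_total n D :
  root_sum (total_coef n) n D = \sum_(i < m) s ord0 i * (b n i * root_sum (x n i) n D).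
Proof.
rewrite /root_sum; under eq_bigr do rewrite mulr_suml.
rewrite exchange_big /=; apply: eq_bigr => i _; rewrite !mulr_sumr.
by apply: eq_bigr => j _; rewrite !mulrA.
Qed.

Lemma root_var_total n : root_var (total_coef n) n
  = \sum_(i < m) \sum_(j < m) s ord0 i * s ord0 j *
     (b n i * b n j * xvar n (rlevel k n (u i) + rlevel k n (u j))).
Proof.
rewrite /root_var.
under eq_bigr do rewrite expr2 mulr_suml mulr_suml.
rewrite exchange_big /=; apply: eq_bigr => i _.
under eq_bigr do rewrite mulr_sumr mulr_suml.
rewrite exchange_big /=; apply: eq_bigr => j _; rewrite /xvar !mulr_sumr.
by apply: eq_bigr => l _; rewrite exprD; ring.
Qed.

Lemma cvg_total_scale : total_scale @ \oo --> (0 : R).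
Proof.
rewrite (_ : 0 = \sum_(i < m) `|s ord0 i| * 0); last first.
  by rewrite big1// => i _; rewrite mulr0.
apply: (@cvg_seq_sum _ _ _ (fun i n => `|s ord0 i| * b n i) (fun i => `|s ord0 i| * 0)).
by move=> i; apply: cvgMl_tmp; exact: cvg_rscale.
Qed.

Lemma cvg_root_var : (fun n => root_var (total_coef n) n) @ \oo --> limit_var.
Proof.
under eq_fun do rewrite root_var_total.
apply: cvg_seq_sum => i; apply: cvg_seq_sum => j.
by apply: cvgMl_tmp; exact: cvg_covariance.
Qed.

Lemma near_small_coef : \forall n \near \oo, total_scale n <= 1 /\
  forall j, (j < n)%N -> `|total_coef n j| <= total_scale n.
Proof.
near=> n; split.
  by near: n; exact: (cvgr_le _ cvg_total_scale _ ltr01).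
have [n0 _] : (0 < n)%N /\ 1 <= ln n%:R :> R by near: n; exact: (near_le_ln hk).
move=> j jn; apply: le_trans (ler_norm_sum _ _ _) _; apply: ler_sum => i _.
rewrite normrM [`|_ * rscale _ _ _|]normrM -mulrA ler_wpM2l// (ger0_norm
  (rscale_ge0 _ _ n0)).
rewrite ler_piMr ?rscale_ge0// ger0_norm ?exprn_ge0 ?xrest_ge0//.
by rewrite exprn_ile1 ?xrest_ge0 ?xrest_le1.
Unshelve. all: by end_near.
Qed.

(** The L1 approximation of each [Yn] passes through a 1-Lipschitz function; it is applied to the
    cosine and the sine. *)
Lemma near_lipschitz (g : R -> R) : (forall y z, `|g z - g y| <= `|z - y|) ->
  \forall n \near \oo,
  `|rrt_expect (fun t : rtree_code n => g (\sum_(i < m) s ord0 i * Yn k (u i) t))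
    - rrt_expect (fun t : rtree_code n => g (root_sum (total_coef n) n (rdepth t)))|
  <= 10 * total_scale n.
Proof.
move=> glip; apply: filterS near_linear => n hn.
rewrite -rrt_expectB; apply: le_trans (rrt_expect_norm _) _.
apply: le_trans (_ : rrt_expect (fun t : rtree_code n => \sum_(i < m) `|s ord0 i| *
   `|Yn k (u i) t - b n i * root_sum (x n i) n (rdepth t)|) <= _).
  apply: rrt_expect_le => t _; apply: le_trans (glip _ _) _.
  rewrite root_sum_total -sumrB; apply: le_trans (ler_norm_sum _ _ _) _.
  by apply: ler_sum => i _; rewrite -mulrBr normrM.
rewrite rrt_expect_sum /total_scale mulr_sumr; apply: ler_sum => i _.
by rewrite rrt_expectZ [leRHS]mulrCA ler_wpM2l.
Qed.

Lemma cvg_cos_char :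
  (fun n => rrt_expect (fun t : rtree_code n => cos (\sum_(i < m) s ord0 i * Yn k
    (u i) t)))
   @ \oo --> expR (- (limit_var / 2)).
Proof.
apply: (cvg_near_dist (b := fun n => expR (- (root_var (total_coef n) n / 2)))
  (c := fun n => 10 * total_scale n + 3 * total_scale n * root_var (total_coef n) n)).
- near=> n.
  have [d1 Cd] : total_scale n <= 1 /\ forall j, (j < n)%N -> `|total_coef n j|
    <= total_scale n.
    by near: n; exact: near_small_coef.
  have [h _] := root_sum_char (leqnn n) d1 Cd.
  rewrite -(subrKA (rrt_expect (fun t : rtree_code n => cos (root_sum (total_coef
    n) n (rdepth t))))).
  apply: le_trans (ler_normD _ _) _; apply: lerD => //.
  by near: n; apply: near_lipschitz; exact: cos_lipschitz.
- rewrite (_ : 0 = 10 * 0 + 3 * 0 * limit_var); last by rewrite !mulr0 mul0r addr0.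
  apply: cvgD; first by apply: cvgMl_tmp; exact: cvg_total_scale.
  by apply: cvgM; [apply: cvgMl_tmp; exact: cvg_total_scale|exact: cvg_root_var].
- apply: (@continuous_cvg _ _ _ _ _ _ (@expR R)); first exact: continuous_expR.
  by apply: cvgN; apply: cvgMr_tmp; exact: cvg_root_var.
Unshelve. all: by end_near.
Qed.

Lemma cvg_sin_char :
  (fun n => rrt_expect (fun t : rtree_code n => sin (\sum_(i < m) s ord0 i * Yn k
    (u i) t)))
   @ \oo --> (0 : R).
Proof.
apply: (cvg_near_dist (b := fun=> 0)
  (c := fun n => 10 * total_scale n + total_scale n * root_var (total_coef n) n)).
- near=> n.
  have [d1 Cd] : total_scale n <= 1 /\ forall j, (j < n)%N -> `|total_coef n j|
    <= total_scale n.
    by near: n; exact: near_small_coef.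
  have [_ h] := root_sum_char (leqnn n) d1 Cd.
  rewrite subr0 -[X in `|X|](subrK (rrt_expect (fun t : rtree_code n => sin
    (root_sum (total_coef n) n (rdepth t))))).
  apply: le_trans (ler_normD _ _) _; apply: lerD => //.
  by near: n; apply: near_lipschitz; exact: sin_lipschitz.
- rewrite (_ : 0 = 10 * 0 + 0 * limit_var); last by rewrite mulr0 mul0r addr0.
  apply: cvgD; first by apply: cvgMl_tmp; exact: cvg_total_scale.
  by apply: cvgM; [exact: cvg_total_scale|exact: cvg_root_var].
- exact: cvg_cst.
Unshelve. all: by end_near.
Qed.

End FiniteDimensional.

Unset Implicit Arguments.

Theorem theorem1p1 (R : realType) (k : nat -> R)
  (k_pos : forall n, 0 < k n)
  (k_infty : k @ \oo --> +oo)
  (k_little : k =o_\oo (fun n : nat => ln (n%:R : R)))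
  (m : nat) (u : 'I_m -> R) (u_pos : forall i, 0 < u i)
  (d : measure_display) (T : measurableType d) (P : probability T R)
  (Z : T -> 'rV[R]_m)
  (HZ : centered_gaussian_vec P Z (\matrix_(i, j) (u i + u j)^-1))
  (f : 'rV[R]_m -> R) (f_cont : continuous f)
  (f_bdd : exists M : R, forall x, `|f x| <= M) :
  (fun n => (@rrt_expect R n (fun t => f (\row_i @Yn R k n (u i) t)))%:E)
    @ \oo --> 'E_P[fun w => f (Z w)]%E.
Proof.
have hk : slow_divergence k.
  split; [exact: k_pos|exact/cvgryPge|].
  by move: k_little => /eqoP.
case: HZ => mZ HZ.
(* The law of the vector of normalized level counts, viewed as a functional on test functions. *)
pose E n (g : 'rV[R]_m -> R) := rrt_expect (fun t : rtree_code n => g (\row_i Yn k (u i) t)).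
have rowE (s : 'rV[R]_m) n (t : rtree_code n) :
    dotr s (\row_i Yn k (u i) t) = \sum_(i < m) s ord0 i * Yn k (u i) t.
  by apply: eq_bigr => i _; rewrite mxE.
apply: (levy_continuity (E := E) (C := 14 + \sum_(j < m) (u j + u j)^-1)) => //.
- by move=> n g h; exact: rrt_expectD.
- by move=> n a g; exact: rrt_expectZ.
- by move=> n a; exact: rrt_expect_cst.
- by move=> n g h gh; apply: rrt_expect_le => t _; exact: gh.
- apply: filterS (near_first_moment hk u_pos) => n hn i.
  by rewrite /E; under eq_rrt_expect do rewrite mxE; exact: hn.
- move=> s; have [Hc _] := HZ s; exists (expR (- (limit_var u s / 2))).
    apply: etrans Hc _; congr ((expR (- _))%:E).
    rewrite [RHS]mulrC; congr (_ * _).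
    by apply: eq_bigr => i _; apply: eq_bigr => j _; rewrite mxE.
  rewrite (_ : E^~ _ = fun n => rrt_expect (fun t : rtree_code n =>
    cos (\sum_(i < m) s ord0 i * Yn k (u i) t))); first exact: cvg_cos_char.
  by apply/funext => n; apply: eq_rrt_expect => t _; rewrite rowE.
- move=> s; have [_ Hs] := HZ s; exists 0; first exact: Hs.
  rewrite (_ : E^~ _ = fun n => rrt_expect (fun t : rtree_code n =>
    sin (\sum_(i < m) s ord0 i * Yn k (u i) t))); first exact: cvg_sin_char.
  by apply/funext => n; apply: eq_rrt_expect => t _; rewrite rowE.
Qed.
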